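(* If $p$ is an odd prime, then the map $G\mapsto \mathcal L(G)$ is a bijection between $\mathrm{UCS}_{p^2}$ and $\mathrm{IAC}_p$. Further, if $G\in\mathrm{UCS}_{p^2}$ and $L=\mathcal L(G)$, then the following hold. (a) There is an isomorphism $\mathrm{Aut}(G)/\mathrm{Aut}_C(G)\cong \mathrm{Aut}(L)$, where $\mathrm{Aut}_C(G)$ denotes the group of central automorphisms of $G$. (b) There is a bijection between the set of subalgebras of $L$ and the set of powerful subgroups of $G$ that contain $\Phi(G)$. (c) The bijection in part (b) restricts to a bijection between ideals of $L$ and powerfully embedded subgroups of $G$ containing $\Phi(G)$. (d) For $k\geq 2$, we have that $G^{\times k}\in\mathrm{UCS}_{p^2}$ and $\mathcal L(G^{\times k})\cong L^{\oplus k}$.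
   Context: A group is UCS if it has a unique non-trivial proper characteristic subgroup. $\mathrm{UCS}_{p^2}$ is the set of isomorphism classes of finite UCS $p$-groups of exponent $p^2$; isomorphism classes are identified with their representatives. An anti-commutative algebra over a field is a (not necessarily associative) algebra, with product written $\llbracket x,y\rrbracket$, satisfying $\llbracket x,x\rrbracket=0$ for all $x$. Such an algebra $L$ is IAC if in addition its automorphism group $\mathrm{Aut}(L)$ acts irreducibly on the vector space $L$. $\mathrm{IAC}_p$ is the set of isomorphism classes of finite-dimensional IAC algebras over the field $\mathbb F_p$ of $p$ elements. Definition of $\mathcal L(G)$: let $p$ be an odd prime and $G$ a finite UCS $p$-group of exponent $p^2$, $\Phi(G)$ its Frattini subgroup, $\overline G=G/\Phi(G)$ (an $\mathbb F_p$-vector space) and $\overline g=g\Phi(G)$. It is known that $\overline g\mapsto g^p$ is a well-defined isomorphism $\overline G\to\Phi(G)$ of $\mathbb F_p\mathrm{Aut}(G)$-modules; for $h\in\Phi(G)$, let $h^{1/p}\in\overline G$ denote the unique preimage of $h$ under this map. Then $\mathcal L(G)$ is the $\mathbb F_p$-algebra with underlying space $\overline G$ and product $\llbracket \overline x,\overline y\rrbracket=[x,y]^{1/p}$, where $[x,y]=x^{-1}y^{-1}xy$. $\mathrm{Aut}_C(G)$ is the kernel of the natural homomorphism $\mathrm{Aut}(G)\to\mathrm{Aut}(G/Z(G))$, where $Z(G)$ is the center of $G$. For $p$ odd, a finite $p$-group $H$ is powerful if $H'\le H^p$, and a subgroup $N$ of a finite $p$-group $G$ is powerfully embedded in $G$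 if $[N,G]\le N^p$; here $H^p$ is the subgroup generated by $p$-th powers and $H'$ is the commutator subgroup. $G^{\times k}$ is the $k$-fold direct power of $G$ and $L^{\oplus k}$ is the direct sum of $k$ copies of the algebra $L$.
   Formalization: Part (a) is stated only for non-abelian G; for every abelian G in the class it fails, e.g. G = C_9, p = 3, where Aut(G)/Aut_C(G) is trivial but Aut(L) has order 2. *)

(* Defs.v *)
From HB Require Import structures.
From mathcomp Require Import all_boot all_order all_algebra sesquilinear.
From mathcomp Require Import all_fingroup all_solvable all_field all_character.

Set Implicit Arguments.
Unset Strict Implicit.
Unset Printing Implicit Defensive.

Import GRing.Theory.
Local Open Scope group_scope.

(* f induces a bijection from the eqX-classes of elements satisfying P onto    *)
(* the eqY-classes of elements satisfying Q.                                  *)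
Definition induces_bijection (X Y : Type) (P : X -> Prop) (eqX : X -> X -> Prop)
    (Q : Y -> Prop) (eqY : Y -> Y -> Prop) (f : X -> Y) : Prop :=
  [/\ forall x, P x -> Q (f x),
      forall x x', P x -> P x' -> eqX x x' -> eqY (f x) (f x'),
      forall x x', P x -> P x' -> eqY (f x) (f x') -> eqX x x' &
      forall y, Q y -> exists2 x, P x & eqY (f x) y].

Section Algebras.

(* Finite-dimensional, not necessarily associative. *)
Record algebra (F : fieldType) := Algebra {
  alg_space :> vectType F;
  alg_mul : {bilinear alg_space -> alg_space -> alg_space}%R
}.

Definition alg_isom (F : fieldType) (A B : algebra F) : Prop :=
  exists2 f : {linear A -> B}, bijective f &
    forall x y, f (alg_mul A x y) = alg_mul B (f x) (f y).

Definition subalgebra (F : fieldType) (L : algebra F) (U : {vspace L}) : Prop :=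
  forall x y, x \in U -> y \in U -> alg_mul L x y \in U.

Definition ideal (F : fieldType) (L : algebra F) (U : {vspace L}) : Prop :=
  forall x y, x \in U -> alg_mul L x y \in U /\ alg_mul L y x \in U.

(* finvect_type L is L itself, equipped with the finType structure that it    *)
(* has over a finite field.                                                   *)
Definition alg_Aut (F : finFieldType) (L : algebra F) :
    {set {perm finvect_type L}} :=
  [set a : {perm finvect_type L}
    | [forall c : F, forall x : finvect_type L, forall y : finvect_type L,
         a (c *: x + y)%R == (c *: a x + a y)%R]
    & [forall x : finvect_type L, forall y : finvect_type L,
         a (alg_mul L x y) == alg_mul L (a x) (a y)]].

(* As usual for irreducible modules, the zero space is excluded. *)
Definition IAC (F : finFieldType) (L : algebra F) : Prop :=
  [/\ forall x : L, alg_mul L x x = 0%R,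
      (fullv : {vspace L}) != 0%VS &
      forall U : {vspace L},
        (forall a, a \in alg_Aut L -> forall u : L, u \in U -> (a u : L) \in U) ->
        U = 0%VS \/ U = fullv].

Section AutGroup.
Variables (F : finFieldType) (L : algebra F).

Fact alg_Aut_group_set : group_set (alg_Aut L).
Proof.
apply/group_setP; split=> [|a b]; rewrite !inE.
  by apply/andP; split; do !apply/forallP=> ?; rewrite !perm1.
case/andP=> /forallP la /forallP ma /andP[/forallP lb /forallP mb].
apply/andP; split.
  apply/forallP=> c; apply/forallP=> x; apply/forallP=> y; rewrite !permM.
  by rewrite (eqP (forallP (forallP (la c) x) y)) (eqP (forallP (forallP (lb c) _) _)).
apply/forallP=> x; apply/forallP=> y; rewrite !permM.
by rewrite (eqP (forallP (ma x) y)) (eqP (forallP (mb _) _)).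
Qed.
Canonical alg_Aut_group := Group alg_Aut_group_set.

End AutGroup.

Section Power.
Variables (F : fieldType) (L : algebra F) (k : nat).

Definition pow_mul (x y : {ffun 'I_k -> L}) : {ffun 'I_k -> L} :=
  [ffun i => alg_mul L (x i) (y i)].

Fact pow_mul_bilinear : bilinear_for
  (GRing.Scale.Law.clone _ _ *:%R _) (GRing.Scale.Law.clone _ _ *:%R _) pow_mul.
Proof.
split=> z c x y; apply/ffunP=> i; rewrite !ffunE.
  by rewrite linearPl.
by rewrite linearPr.
Qed.
HB.instance Definition _ := bilinear_isBilinear.Build _ _ _ _ _ _ _ pow_mul_bilinear.

(* L (+) ... (+) L, with k summands. *)
Definition alg_pow : algebra F := Algebra (pow_mul : {bilinear _ -> _ -> _}%R).

End Power.

End Algebras.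

(* An elementary abelian p-group E, written additively, as a vector space     *)
(* over 'F_p. The hypothesis E :!=: 1 is only needed to reuse abelem_rV.      *)
Section AbelemSpace.
Variables (p : nat) (gT : finGroupType) (E : {group gT}).

Definition abelem_space (abelE : p.-abelem E) (ntE : E :!=: 1) : predArgType :=
  subg_of E.

Variables (abelE : p.-abelem E) (ntE : E :!=: 1).
Local Notation V := (abelem_space abelE ntE).

Fact abelem_spaceC : @commutative (subg_of E) _ mulg.
Proof.
move=> x y; apply: val_inj => /=.
exact: (centsP (abelem_abelian abelE)) (subgP x) _ (subgP y).
Qed.

Definition abelem_scale (a : 'F_p) (x : subg_of E) : subg_of E := x ^+ (a : nat).

Definition abelem_coord (x : subg_of E) : 'rV['F_p](E) :=
  abelem_rV abelE ntE (val x).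

Fact abelem_coord_bij : bijective abelem_coord.
Proof.
exists (fun v => subg E (rVabelem abelE ntE v)) => [x | v].
  by rewrite /abelem_coord abelem_rV_K ?subgP ?sgvalK.
by rewrite /abelem_coord subgK ?mem_rVabelem ?rVabelemK.
Qed.

Fact abelem_coordM : {morph abelem_coord : x y / x * y >-> (x + y)%R}.
Proof. by move=> x y; rewrite /abelem_coord /= abelem_rV_M ?subgP. Qed.

Fact abelem_coordZ a : {morph abelem_coord : x / abelem_scale a x >-> (a *: x)%R}.
Proof.
move=> x; rewrite /abelem_coord /abelem_scale /=.
have -> : val (x ^+ (a : nat)) = val x ^+ (a : nat).
  by elim: (a : nat) => // n IHn; rewrite !expgS /= IHn.
by rewrite abelem_rV_X ?subgP // natr_Zp.
Qed.

HB.instance Definition _ := Finite.copy V (subg_of E).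

HB.instance Definition _ := GRing.isZmodule.Build V
  (@mulgA (subg_of E)) abelem_spaceC (@mul1g (subg_of E)) (@mulVg (subg_of E)).

Let scale (a : 'F_p) (x : V) : V := abelem_scale a x.
Let coord (x : V) := abelem_coord x.
Let coord_inj : injective coord := bij_inj abelem_coord_bij.
Let coordD (x y : V) : coord (x + y)%R = (coord x + coord y)%R :=
  abelem_coordM x y.
Let coordZ a x : coord (scale a x) = (a *: coord x)%R := abelem_coordZ a x.

Fact abelem_scaleA a b x : scale a (scale b x) = scale (a * b)%R x.
Proof. by apply: coord_inj; rewrite !coordZ scalerA. Qed.
Fact abelem_scale1 : left_id 1%R scale.
Proof. by move=> x; apply: coord_inj; rewrite coordZ scale1r. Qed.
Fact abelem_scaleDr : right_distributive scale +%R.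
Proof.
by move=> a x y; apply: coord_inj; rewrite !(coordZ, coordD) scalerDr.
Qed.
Fact abelem_scaleDl x : {morph scale^~ x : a b / (a + b)%R}.
Proof.
by move=> a b /=; apply: coord_inj; rewrite !(coordZ, coordD) scalerDl.
Qed.
HB.instance Definition _ := GRing.Zmodule_isLmodule.Build 'F_p V
  abelem_scaleA abelem_scale1 abelem_scaleDr abelem_scaleDl.

Fact abelem_fin_dim : Vector.axiom ('dim E) V.
Proof.
exists coord; first by move=> a x y; rewrite coordD coordZ.
exact: abelem_coord_bij.
Qed.
HB.instance Definition _ := Lmodule_hasFinDim.Build 'F_p V abelem_fin_dim.

End AbelemSpace.

Section Groups.

Definition UCS (gT : finGroupType) (G : {group gT}) : Prop :=
  exists! H : {group gT}, [/\ H \char G, H :!=: 1 & H \proper G].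

Definition in_UCSp2 (p : nat) (gT : finGroupType) (G : {group gT}) : Prop :=
  [/\ p.-group G, exponent G = (p ^ 2)%N & UCS G].

Record UCSp2 (p : nat) := MkUCSp2 {
  UCS_type : finGroupType;
  UCS_group :> {group UCS_type};
  UCSP : in_UCSp2 p UCS_group
}.

Definition direct_power (gT : finGroupType) (G : {group gT}) (k : nat) :
    {group {dffun forall i : 'I_k, gT}} :=
  [group of setXn (fun _ : 'I_k => G)].

Variable gT : finGroupType.

Definition ppowers (p : nat) (H : {set gT}) : {set gT} :=
  <<[set x ^+ p | x in H]>>.

(* The next two notions are the ones for odd p. *)
Definition powerful (p : nat) (H : {set gT}) : bool := H^`(1) \subset ppowers p H.

Definition powerfully_embedded (p : nat) (N G : {set gT}) : bool :=
  (N \subset G) && ([~: N, G] \subset ppowers p N).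

(* Kernel of Aut G -> Aut (G / 'Z(G)): the automorphism induced by a maps the *)
(* coset of x to the coset of a x.                                            *)
Definition Aut_C (G : {set gT}) : {set {perm gT}} :=
  [set a in Aut G | [forall x in G, coset 'Z(G) (a x) == coset 'Z(G) x]].

Fact Aut_C_group_set (G : {group gT}) : group_set (Aut_C G).
Proof.
apply/group_setP; split=> [|a b].
  by rewrite inE group1; apply/forall_inP=> x _; rewrite perm1.
case/setIdP=> Aa /forall_inP Ca /setIdP[Ab /forall_inP Cb].
rewrite inE groupM //=; apply/forall_inP=> x Gx; rewrite permM.
by rewrite (eqP (Cb _ _)) ?Ca ?Aut_closed.
Qed.
Canonical Aut_C_group (G : {group gT}) := Group (Aut_C_group_set G).

Fact Aut_C_normal (G : {group gT}) : Aut_C G <| Aut G.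
Proof.
apply/andP; split; first by apply/subsetP=> a /setIdP[].
apply/subsetP=> b Ab; rewrite inE; apply/subsetP=> _ /imsetP[a Ca ->].
have [Aa /forall_inP Cax] := setIdP Ca.
rewrite inE groupJ //=; apply/forall_inP=> x Gx.
have Gy : b^-1 x \in G by rewrite Aut_closed ?groupV.
have Gay : a (b^-1 x) \in G by rewrite Aut_closed.
have nZ := subsetP (char_norm (center_char G)).
have /rcoset_kercosetP := eqP (Cax _ Gy).
rewrite !nZ // => /(_ isT isT) /rcosetP[z Zz eq_ay].
have AutM u v : u \in G -> v \in G -> b (u * v) = b u * b v.
  by have /morphicP := Aut_morphic Ab; apply.
have Zbz : b z \in 'Z(G).
  have /charP[_ /(_ (autm_morphism Ab))] := center_char G.
  rewrite injm_autm im_autm => /(_ isT (erefl _)) /= imZ.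
  by rewrite -imZ -[b z]/(autm Ab z) mem_morphim // (subsetP (center_sub G)).
rewrite conjgE !permM eq_ay AutM ?(subsetP (center_sub G) _ Zz) //.
rewrite -[b (_ x)]permM mulVg perm1.
by rewrite morphM ?nZ ?(subsetP (center_sub G) _ Zbz) //= coset_id ?mul1g.
Qed.

End Groups.

(* The algebra L(G) on the vector space G / 'Phi(G), with product             *)
(* [[x, y]] = [~ x, y]^(1/p).                                                 *)
Section FrattiniAlgebra.
Variables (p : nat) (odd_p : odd p) (G : UCSp2 p).

Let pG : p.-group G.
Proof. by case: (UCSP G). Qed.

Fact UCS_exponent : exponent G = (p ^ 2)%N.
Proof. by case: (UCSP G). Qed.

Fact UCS_ucs : UCS G.
Proof. by case: (UCSP G). Qed.

Fact UCS_neq1 : G :!=: 1.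
Proof.
have [H [[_ ntH /proper_sub sHG] _]] := UCS_ucs.
by apply: contraNneq ntH => G1; rewrite -subG1 -G1.
Qed.

Fact UCS_prime : prime p.
Proof. by have [] := pgroup_pdiv pG UCS_neq1. Qed.

Fact UCS_not_expp : ~ {in G, forall x, x ^+ p = 1}.
Proof.
move=> xp1; have /dvdn_leq : exponent G %| p by apply/exponentP.
rewrite UCS_exponent prime_gt0 ?UCS_prime // => /(_ isT).
by rewrite leqNgt -{1}[p]expn1 ltn_exp2l ?prime_gt1 ?UCS_prime.
Qed.

Fact UCS_Phi_neq1 : 'Phi(G) != 1.
Proof.
rewrite (trivg_Phi pG); apply/negP=> /(abelemP UCS_prime)[_ xp1].
exact: UCS_not_expp.
Qed.

Fact UCS_Phi_proper : 'Phi(G) \proper G.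
Proof. exact: Phi_proper UCS_neq1. Qed.

Fact UCS_char (H : {group UCS_type G}) :
  H \char G -> [\/ H :=: 1, H :=: 'Phi(G) | H :=: G].
Proof.
move=> chH; have [K [_ uniqK]] := UCS_ucs.
have [H1 | ntH] := eqVneq (H : {set _}) 1; first by constructor 1.
have [HG | neHG] := eqVneq (H : {set _}) G; first by constructor 3.
constructor 2; rewrite -(uniqK H); last by rewrite properEneq neHG char_sub.
by rewrite (uniqK 'Phi(G)%G) ?Phi_char ?UCS_Phi_neq1 ?UCS_Phi_proper.
Qed.

Fact UCS_quotient_neq1 : G / 'Phi(G) != 1.
Proof.
rewrite -subG1 quotient_sub1 ?gFnorm //.
by have /andP[] := UCS_Phi_proper.
Qed.

Fact UCS_Phi_central : 'Phi(G) \subset 'Z(G).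
Proof.
have [/=|->|/= ->] := UCS_char (center_char G) => //; last exact: Phi_sub.
move/eqP; rewrite center_nil_eq1 ?(pgroup_nil pG) // => /eqP G1.
by have:= UCS_neq1; rewrite G1 eqxx.
Qed.

Fact UCS_Phi_abelem : p.-abelem 'Phi(G).
Proof.
have pPhi : p.-group 'Phi(G) := pgroupS (Phi_sub G) pG.
have prPP := Phi_proper UCS_Phi_neq1.
rewrite -(trivg_Phi pPhi).
have [->|/= eqP|/= eqP] := UCS_char (char_trans (Phi_char _) (Phi_char G)) => //.
  by rewrite eqP properxx in prPP.
by have:= proper_trans prPP UCS_Phi_proper; rewrite eqP properxx.
Qed.

Fact UCS_PhiX x : x \in 'Phi(G) -> x ^+ p = 1.
Proof. by case/(abelemP UCS_prime): UCS_Phi_abelem => _; apply. Qed.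

Fact UCS_comm_Phi x y : x \in G -> y \in G -> [~ x, y] \in 'Phi(G).
Proof.
move=> Gx Gy; rewrite (Phi_joing pG).
by apply: (subsetP (joing_subl _ _)); apply: mem_commg.
Qed.

Fact UCS_commute x y : x \in 'Phi(G) -> y \in G -> commute x y.
Proof.
move=> /(subsetP UCS_Phi_central)/centerP[_ cx] Gy; exact: cx.
Qed.

Fact UCS_comm1 x y : x \in 'Phi(G) -> y \in G -> [~ x, y] = 1.
Proof. by move=> Px Gy; apply/eqP/commgP/UCS_commute. Qed.

Fact UCS_commM x y z : x \in G -> y \in G -> z \in G ->
  [~ x * y, z] = [~ x, z] * [~ y, z].
Proof.
move=> Gx Gy Gz; rewrite commMgJ; congr (_ * _).
by rewrite conjgE (UCS_commute (UCS_comm_Phi Gx Gz) Gy) mulKg.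
Qed.

Fact UCS_expMp x y : x \in G -> y \in G -> (x * y) ^+ p = x ^+ p * y ^+ p.
Proof.
move=> Gx Gy; have cR (z : UCS_type G) : z \in G -> commute z [~ y, x].
  by move=> Gz; apply: commute_sym; rewrite /commute UCS_commute ?UCS_comm_Phi.
rewrite expMg_Rmul; [|exact: cR..]; rewrite bin2odd // expgM (UCS_PhiX (UCS_comm_Phi Gy Gx)).
by rewrite expg1n mulg1.
Qed.
Canonical UCS_powp_morphism :=
  @Morphism _ _ G (expgn^~ p) (fun x y Gx Gy => UCS_expMp Gx Gy).

Fact UCS_im_powp : expgn^~ p @: G = 'Phi(G).
Proof.
have imM : 'Mho^1(G) = expgn^~ p @: G.
  rewrite (MhoE 1 pG) expn1 -[_ @: _]/([set x ^+ p | x in G]).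
  have -> : [set x ^+ p | x in G] = UCS_powp_morphism @* G.
    by rewrite morphimEdom.
  exact: genGid.
have sMP : 'Mho^1(G) \subset 'Phi(G) by rewrite (Phi_joing pG) joing_subr.
rewrite -imM; have [M1|//|MG] := UCS_char (Mho_char 1 G).
  case: UCS_not_expp => x Gx.
  have : x ^+ p \in 'Mho^1(G) by rewrite imM; apply/imsetP; exists x.
  by rewrite M1 => /set1P.
have := sMP; rewrite /= MG.
by have /andP[_ /negPf->] := UCS_Phi_proper.
Qed.

Fact UCS_ker_powp x : x \in G -> (x ^+ p == 1) = (x \in 'Phi(G)).
Proof.
move=> Gx; apply/eqP/idP=> [xp1 | ]; last exact: UCS_PhiX.
have O_x : x \in 'Ohm_1(G).
  by rewrite (OhmE 1 pG) expn1 mem_gen // !inE Gx xp1 /=.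
have sO : 'Ohm_1(G) \subset 'ker UCS_powp_morphism.
  rewrite (OhmE 1 pG) expn1 gen_subG; apply/subsetP=> y /setIP[Gy].
  by rewrite !inE => /eqP yp1; rewrite Gy /= yp1.
have [O1|<- //|OG] := UCS_char (Ohm_char 1 G).
  by move: O_x; rewrite /= O1 => /set1P->.
case: UCS_not_expp => y Gy; apply: (@mker _ _ _ UCS_powp_morphism).
by rewrite (subsetP sO) //= OG.
Qed.

Definition Frattini_space : predArgType :=
  abelem_space (Phi_quotient_abelem pG) UCS_quotient_neq1.
HB.instance Definition _ := Finite.on Frattini_space.
HB.instance Definition _ := Vector.on Frattini_space.
Implicit Types u v w : Frattini_space.

Definition Frattini_bar (x : UCS_type G) : Frattini_space :=
  subg (G / 'Phi(G)) (coset 'Phi(G) x).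

Definition Frattini_lift u : UCS_type G := repr (sgval u).

(* The isomorphism G / 'Phi(G) -> 'Phi(G) induced by x |-> x ^+ p, and its    *)
(* inverse; see pth_power_bar, pth_powerD, pth_powerK and pth_rootK.          *)
Definition pth_power u : UCS_type G := Frattini_lift u ^+ p.

Definition pth_root (h : UCS_type G) : Frattini_space :=
  odflt 0%R [pick u | pth_power u == h].

(* Independent of the representatives by Frattini_mul_bar. *)
Definition Frattini_mul u v : Frattini_space :=
  pth_root [~ Frattini_lift u, Frattini_lift v].

Let sGN : G \subset 'N('Phi(G)) := gFnorm _ _.

Fact Frattini_barK u : Frattini_bar (Frattini_lift u) = u.
Proof. by rewrite /Frattini_bar coset_reprK sgvalK. Qed.

Fact Frattini_liftG u : Frattini_lift u \in G.
Proof.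
have /morphimP[x Nx Gx ux] := subgP u; rewrite /Frattini_lift ux.
have := mem_repr_coset (coset 'Phi(G) x); rewrite val_coset //.
by case/rcosetP=> y Py ->; rewrite groupM // (subsetP (Phi_sub G)).
Qed.

Fact Frattini_lift_bar x :
  x \in G -> exists2 z, z \in 'Phi(G) & Frattini_lift (Frattini_bar x) = z * x.
Proof.
move=> Gx; rewrite /Frattini_lift /Frattini_bar subgK ?mem_quotient //.
have := mem_repr_coset (coset 'Phi(G) x).
by rewrite val_coset ?(subsetP sGN) // => /rcosetP[z Pz ->]; exists z.
Qed.

Fact Frattini_barM x y : x \in G -> y \in G ->
  Frattini_bar (x * y) = (Frattini_bar x + Frattini_bar y)%R.
Proof.
move=> Gx Gy; apply: val_inj.
rewrite /= !subgK ?mem_quotient ?groupM //.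
by apply: morphM; apply: (subsetP sGN).
Qed.

Fact Frattini_barX (a : 'F_p) x : x \in G ->
  Frattini_bar (x ^+ (a : nat)) = (a *: Frattini_bar x)%R.
Proof.
move=> Gx; transitivity (Frattini_bar x *+ (a : nat))%R.
  elim: (a : nat) => [|n IHn].
    by apply: val_inj; rewrite /= subgK ?morph1 ?group1.
  by rewrite expgS Frattini_barM ?groupX // IHn mulrS.
by rewrite -scaler_nat natr_Zp.
Qed.

Fact pth_power_bar x : x \in G -> pth_power (Frattini_bar x) = x ^+ p.
Proof.
move=> Gx; rewrite /pth_power; have [z Pz ->] := Frattini_lift_bar Gx.
by rewrite UCS_expMp ?(subsetP (Phi_sub G) _ Pz) // UCS_PhiX // mul1g.
Qed.

Fact pth_powerD u v : pth_power (u + v)%R = pth_power u * pth_power v.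
Proof.
rewrite -(Frattini_barK u) -(Frattini_barK v) -Frattini_barM ?Frattini_liftG //.
by rewrite !pth_power_bar ?groupM ?Frattini_liftG // UCS_expMp ?Frattini_liftG.
Qed.

Fact pth_powerZ (a : 'F_p) u : pth_power (a *: u)%R = pth_power u ^+ a.
Proof.
rewrite -(Frattini_barK u) -Frattini_barX ?Frattini_liftG //.
by rewrite !pth_power_bar ?groupX ?Frattini_liftG // -!expgM mulnC.
Qed.

Fact pth_power_inj : injective pth_power.
Proof.
have ker0 u : pth_power u = 1 -> u = 0%R.
  move/eqP; rewrite UCS_ker_powp ?Frattini_liftG // => Pu.
  rewrite -(Frattini_barK u) /Frattini_bar coset_id //.
  by apply: val_inj; rewrite /= subgK ?group1.
move=> u v euv; apply/eqP; rewrite -subr_eq0; apply/eqP/ker0.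
apply: (@mulIg _ (pth_power v)).
by rewrite -pth_powerD subrK mul1g.
Qed.

Fact pth_power_Phi u : pth_power u \in 'Phi(G).
Proof. by rewrite -UCS_im_powp; apply: imset_f; apply: Frattini_liftG. Qed.

Fact pth_rootK h : h \in 'Phi(G) -> pth_power (pth_root h) = h.
Proof.
rewrite -UCS_im_powp => /imsetP[x Gx ->]; rewrite /pth_root.
case: pickP => [u /eqP // | /(_ (Frattini_bar x))].
by rewrite pth_power_bar // eqxx.
Qed.

Fact pth_powerK : cancel pth_power pth_root.
Proof. by move=> u; apply: pth_power_inj; rewrite pth_rootK ?pth_power_Phi. Qed.

Fact Frattini_mul_bar x y : x \in G -> y \in G ->
  Frattini_mul (Frattini_bar x) (Frattini_bar y) = pth_root [~ x, y].
Proof.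
move=> Gx Gy; rewrite /Frattini_mul.
have [z Pz ->] := Frattini_lift_bar Gx; have [t Pt ->] := Frattini_lift_bar Gy.
have [Gz Gt] := (subsetP (Phi_sub G) _ Pz, subsetP (Phi_sub G) _ Pt).
rewrite UCS_commM ?groupM // UCS_comm1 ?groupM // mul1g.
by rewrite -invg_comm UCS_commM // UCS_comm1 // mul1g invg_comm.
Qed.

Fact pth_power_mul u v :
  pth_power (Frattini_mul u v) = [~ Frattini_lift u, Frattini_lift v].
Proof. by rewrite pth_rootK // UCS_comm_Phi ?Frattini_liftG. Qed.


Fact Frattini_mulC u v : Frattini_mul v u = (- Frattini_mul u v)%R.
Proof.
apply/eqP; rewrite -addr_eq0; apply/eqP/pth_power_inj.
rewrite pth_powerD !pth_power_mul -[[~ Frattini_lift v, _]]invg_comm mulVg.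
by apply: (mulgI (pth_power 0%R)); rewrite -pth_powerD addr0 mulg1.
Qed.

Fact Frattini_mul_linearl v : linear (Frattini_mul^~ v).
Proof.
move=> a u w; apply: pth_power_inj.
rewrite pth_powerD pth_powerZ -(Frattini_barK u) -(Frattini_barK v).
rewrite -(Frattini_barK w) -Frattini_barX -?Frattini_barM;
  rewrite ?groupX ?Frattini_liftG //.
rewrite !Frattini_mul_bar ?pth_rootK ?UCS_comm_Phi ?UCS_commM;
  rewrite ?groupM ?groupX ?Frattini_liftG //.
have Gg := Frattini_liftG; have cR := UCS_comm_Phi (Gg u) (Gg v).
by rewrite commXg //; apply/commute_sym; exact: (UCS_commute cR).
Qed.

Fact Frattini_mul_bilinear : bilinear_for
  (GRing.Scale.Law.clone _ _ *:%R _) (GRing.Scale.Law.clone _ _ *:%R _)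
  Frattini_mul.
Proof.
split=> u; first exact: Frattini_mul_linearl.
move=> a v w; rewrite ![Frattini_mul u _]Frattini_mulC.
by rewrite Frattini_mul_linearl opprD /= scalerN.
Qed.
HB.instance Definition _ :=
  bilinear_isBilinear.Build _ _ _ _ _ _ _ Frattini_mul_bilinear.

Definition Frattini_algebra : algebra 'F_p :=
  Algebra (Frattini_mul : {bilinear _ -> _ -> _}%R).

End FrattiniAlgebra.

(* Main.v *)
(* A UCS p-group G of exponent p^2 is studied through coordinates: surjective
   additive maps pi : G -> L with kernel {x | x ^+ p = 1} = {y ^+ p} such that
   [~ x, y] = z ^+ p whenever pi z = [[pi x, pi y]]. Two facts carry the proof.
   An isomorphism L -> M always lifts to an isomorphism of coordinatized groups,
   so G is determined by L, Aut G -> Aut L is onto, and irreducibility of L is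
   the same as G being UCS. Conversely every anti-commutative L is coordinatized
   by a twist of the addition of (Z/p^2)^n. Direct powers of G are coordinatized
   by direct sums of L, and these are again irreducible: Aut L moves every nonzero
   vector, so an invariant subspace contains a vector of a single summand. *)

Require Import Defs.
From HB Require Import structures.
From mathcomp Require Import all_boot all_order all_algebra sesquilinear.
From mathcomp Require Import all_fingroup all_solvable all_field all_character.

Set Implicit Arguments.
Unset Strict Implicit.
Unset Printing Implicit Defensive.

Import GRing.Theory.
Local Open Scope group_scope.

(** * Coordinate maps from a group to an algebra *)

(** [coord_comm] relates three group elements, so that no p-th root has to be chosen. *)
Record coordinatized (p : nat) (gT : finGroupType) (G : {group gT})
    (L : algebra 'F_p) (pi : gT -> L) : Prop := Coordinatized {
  coordM : {in G &, {morph pi : x y / x * y >-> (x + y)%R}};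
  coord_surj : forall v, exists2 x, x \in G & pi x = v;
  coord_expp : {in G, forall x, (x ^+ p == 1) = (pi x == 0%R)};
  coord_ker : {in G, forall x, pi x = 0%R -> exists2 y, y \in G & x = y ^+ p};
  coord_comm : {in G & &, forall x y z,
    pi z = alg_mul L (pi x) (pi y) -> [~ x, y] = z ^+ p}
}.

Section Coordinates.

Variables (p : nat) (p_pr : prime p) (odd_p : odd p).
Variables (gT : finGroupType) (G : {group gT}) (L : algebra 'F_p) (pi : gT -> L).
Hypothesis cG : coordinatized G pi.

Lemma coord1 : pi 1 = 0%R.
Proof.
by apply: (addrI (pi 1)); rewrite -(coordM cG) ?group1 // mulg1 addr0.
Qed.

Lemma coordV : {in G, {morph pi : x / x^-1 >-> (- x)%R}}.
Proof.
move=> x Gx; apply/eqP; rewrite -addr_eq0 -(coordM cG) ?groupV //.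
by rewrite mulVg coord1.
Qed.

Lemma coordX n : {in G, forall x, pi (x ^+ n) = (pi x *+ n)%R}.
Proof.
move=> x Gx; elim: n => [|n IHn]; first by rewrite coord1.
by rewrite expgS (coordM cG) ?groupX // IHn mulrS.
Qed.

Lemma coord_powp : {in G, forall x, pi (x ^+ p) = 0%R}.
Proof. by move=> x Gx; rewrite coordX // -scaler_nat pchar_Fp_0 // scale0r. Qed.

Lemma coord_comm0 : {in G &, forall x y, pi [~ x, y] = 0%R}.
Proof.
move=> x y Gx Gy; rewrite /commg /conjg !(coordM cG) ?coordV ?groupM ?groupV //.
by rewrite [(pi x + _)%R]addrC !addKr ?addNr.
Qed.

(** The kernel of [pi] is central: when [pi x = 0] the product vanishes, and [z = 1] is admissible
    in [coord_comm]. *)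
Lemma coord_commute : {in G &, forall x y, pi x = 0%R -> commute x y}.
Proof.
move=> x y Gx Gy x0; apply/commgP/eqP.
by rewrite (coord_comm cG Gx Gy (group1 G)) ?expg1n // coord1 x0 linear0l.
Qed.

Lemma coord_commpX : {in G &, forall x y, [~ x, y] ^+ p = 1}.
Proof.
move=> x y Gx Gy; apply/eqP.
by rewrite (coord_expp cG) ?groupR // coord_comm0.
Qed.

(** Commutators are central, so the correction term is [[~ y, x]] to the power p(p-1)/2. As p is
    odd, this exponent is a multiple of p, which kills commutators. *)
Lemma coord_expMp : {in G &, forall x y, (x * y) ^+ p = x ^+ p * y ^+ p}.
Proof.
move=> x y Gx Gy.
have cR (z : gT) : z \in G -> commute z [~ y, x].
  by move=> Gz; apply/commute_sym/coord_commute; rewrite ?groupR ?coord_comm0.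
rewrite expMg_Rmul; [|exact: cR..]; rewrite bin2odd // expgM coord_commpX //.
by rewrite expg1n mulg1.
Qed.

(** Thus p-th powering identifies L with the kernel of [pi]: equality in L can be tested inside the
    group, in a form that every isomorphism respects. *)
Lemma coord_expp_eq : {in G &, forall x y, (x ^+ p == y ^+ p) = (pi x == pi y)}.
Proof.
move=> x y Gx Gy; rewrite -subr_eq0 -coordV // -(coordM cG) ?groupV //.
rewrite -(coord_expp cG) ?groupM ?groupV // coord_expMp ?groupV // expgVn.
by rewrite -eq_mulgV1.
Qed.

End Coordinates.

(** * Lifting algebra isomorphisms to group isomorphisms *)

Lemma exp_pair (gT hT : finGroupType) (d : gT * hT) n :
  d ^+ n = (d.1 ^+ n, d.2 ^+ n).
Proof. by elim: n => [|n IHn] //; rewrite !expgS IHn. Qed.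

(* The fibre product of G and H over f : L -> M is elementary abelian modulo its
   p-th powers, because f preserves products. The graph of the isomorphism is a
   complement there to the vertical subgroup 1 x ker rho. *)
Lemma coord_lift (p : nat) (gT hT : finGroupType) (G : {group gT})
    (H : {group hT}) (L M : algebra 'F_p) (pi : gT -> L) (rho : hT -> M)
    (f : L -> M) :
    prime p -> odd p -> coordinatized G pi -> coordinatized H rho ->
    {morph f : x y / (x + y)%R} ->
    {morph f : x y / alg_mul L x y >-> alg_mul M x y} -> bijective f ->
  exists phi : {morphism G >-> hT},
    isom G H phi /\ {in G, forall x, rho (phi x) = f (pi x)}.
Proof.
move=> p_pr odd_p cG cH fD fM bij_f.
have f0 : f 0%R = 0%R by apply: (addrI (f 0%R)); rewrite -fD !addr0.
have f_eq0 x : (f x == 0%R) = (x == 0%R).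
  by rewrite -f0 (inj_eq (bij_inj bij_f)).
pose D0 := [set d : gT * hT | [&& d.1 \in G, d.2 \in H & f (pi d.1) == rho d.2]].
have D0P d : reflect [/\ d.1 \in G, d.2 \in H & f (pi d.1) = rho d.2] (d \in D0).
  by rewrite inE; apply: (iffP and3P) => [] [? ? /eqP].
have gD : group_set D0.
  apply/group_setP; split=> [|d e /D0P[Gd Hd fd] /D0P[Ge He fe]].
    by apply/D0P; rewrite !group1 (coord1 cG) (coord1 cH).
  by apply/D0P; rewrite !groupM // (coordM cG) // (coordM cH) // fD fd fe.
pose D := Group gD.
have DP d : reflect [/\ d.1 \in G, d.2 \in H & f (pi d.1) = rho d.2] (d \in D).
  exact: D0P.
have powM : {in D &, {morph (fun d : gT * hT => d ^+ p) : d e / d * e}}.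
  move=> d e /DP[Gd Hd _] /DP[Ge He _] /=.
  rewrite !exp_pair /= (coord_expMp odd_p cG) // (coord_expMp odd_p cH) //.
(* Since p-th powering is multiplicative on [D], its image [E] consists of p-th powers only. *)
pose pw := Morphism powM; pose E := (pw @* D)%G.
have EP d : reflect (exists2 e, e \in D & d = e ^+ p) (d \in E).
  apply: (iffP morphimP) => [[e _ De ->]|[e De ->]]; first by exists e.
  by exists e.
have EG d : d \in E -> [/\ d \in D, pi d.1 = 0%R & rho d.2 = 0%R].
  case/EP=> e De ->; rewrite groupX //; have /DP[Ge He _] := De.
  by rewrite exp_pair /= (coord_powp p_pr cG) // (coord_powp p_pr cH).
have nED : E <| D.
  apply/andP; split; first by apply/subsetP=> d /EG[].
  apply/cents_norm/centsP=> d /DP[Gd Hd _] e /EG[/DP[Ge He _] e1 e2].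
  apply/commute_sym; case: d e {Ge He e1 e2}Gd Hd Ge He e1 e2 => d1 d2 [e1 e2] /=.
  move=> Gd Hd Ge He ze1 ze2; congr (_, _) => /=.
    exact: (coord_commute cG).
  exact: (coord_commute cH).
have pDE : p.-abelem (D / E).
  apply/(abelemP p_pr); split.
    apply: sub_der1_abelian; rewrite gen_subG; apply/subsetP=> _ /imset2P[d e Dd De ->].
    have /DP[Gd Hd fd] := Dd; have /DP[Ge He fe] := De.
    have [z Gz zde] := coord_surj cG (alg_mul L (pi d.1) (pi e.1)).
    have [t Ht tde] := coord_surj cH (alg_mul M (rho d.2) (rho e.2)).
    apply/EP; exists (z, t).
      by apply/DP; split=> //=; rewrite zde tde fM fd fe.
    rewrite exp_pair /= -(coord_comm cG Gd Ge Gz zde) //.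
    by rewrite -(coord_comm cH Hd He Ht tde).
  move=> _ /morphimP[d Nd Dd ->]; rewrite -morphX //.
  by apply: coset_id; apply/EP; exists d.
pose N0 := [set d in D | d.1 == 1].
have gN : group_set N0.
  apply/group_setP; split=> [|d e]; first by rewrite inE group1 eqxx.
  move=> /setIdP[Dd /eqP d1] /setIdP[De /eqP e1]; apply/setIdP.
  by rewrite groupM //= d1 e1 mulg1 eqxx.
pose N := Group gN.
have sND : N \subset D by apply/subsetP=> d /setIdP[].
(* [K] will be the preimage in [D] of a complement to the image of the vertical subgroup [N]; it
   contains [E]. *)
have /splitsP[Kb /complP[tiK defD]] := abelem_splits pDE (quotientS E sND).
have sKbD : Kb \subset D / E by rewrite -defD mulG_subr.
have [K defK sEK sKD] := inv_quotientS nED sKbD.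
have KN d : d \in K -> d.1 = 1 -> d = 1.
  move=> Kd d1; have Dd := subsetP sKD d Kd; have /DP[Gd Hd fd] := Dd.
  have : coset E d \in (N / E) :&: Kb.
    apply/setIP; split.
      by apply: mem_quotient; apply/setIdP; rewrite Dd d1.
    by rewrite defK mem_quotient.
  rewrite tiK => /set1P/coset_idr; rewrite (subsetP (normal_norm nED)) // => /(_ isT).
  (* An element of [E] with first component 1 is trivial: it is [e ^+ p] with [pi e.1 = 0], hence
     [rho e.2 = 0], hence [e.2 ^+ p = 1]. *)
  case/EP=> e De dE; have /DP[Ge He fe] := De.
  have e0 : pi e.1 = 0%R.
    by apply/eqP; rewrite -(coord_expp cG) // -d1 dE exp_pair.
  have : e.2 ^+ p == 1 by rewrite (coord_expp cH) // -fe e0 f0.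
  move/eqP=> e2; rewrite dE exp_pair e2.
  by have := d1; rewrite dE exp_pair /= => ->.
have K1 x : x \in G -> exists2 y, y \in H & (x, y) \in K.
  move=> Gx; have [y Hy rhoy] := coord_surj cH (f (pi x)).
  have Dxy : (x, y) \in D by apply/DP; split.
  have : coset E (x, y) \in D / E by rewrite mem_quotient.
  (* Modulo [E], which lies in [K], the pair is a product of elements of [N] and [K]; the factor
     from [N] does not affect the first component. *)
  rewrite -defD => /mulsgP[_ k /morphimP[n Nn0 /setIdP[Dn /eqP n1] ->]].
  rewrite defK => /morphimP[k' Nk' Kk' ->{k}]; rewrite -morphM // => /eqP.
  have Dk' := subsetP sKD _ Kk'.
  have nD := subsetP (normal_norm nED).
  rewrite eq_sym; move/eqP/rcoset_kercosetP.
  rewrite !nD ?groupM // => /(_ isT isT) /rcosetP[e Ee].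
  rewrite -[n * k']mulg1 => nk'.
  have [De e0 _] := EG _ Ee.
  have : e^-1 * (n * k') = (x, y) by rewrite -[n * k']mulg1 nk' mulKg.
  move=> xy; have xE : x = (e^-1 * k').1.
    by have := congr1 fst xy; rewrite /= n1 mul1g => <-.
  exists (e^-1 * k').2.
    by have /DP[] : e^-1 * k' \in D by rewrite groupM ?groupV.
  by rewrite xE -surjective_pairing groupM // groupV (subsetP sEK).
have KD x y : (x, y) \in K -> [/\ x \in G, y \in H & f (pi x) = rho y].
  by move/(subsetP sKD)/DP.
(* [K] is the graph of a map on [G]; outside [G] the value is the default 1. *)
pose phi0 x := odflt 1 [pick y | (x, y) \in K].
have phiK x : x \in G -> (x, phi0 x) \in K.
  move=> Gx; rewrite /phi0; case: pickP => [//|/=].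
  by have [y _ Kxy] := K1 x Gx => /(_ y); rewrite Kxy.
have Kuniq x y y' : (x, y) \in K -> (x, y') \in K -> y = y'.
  move=> Ky Ky'; have Kd : (x, y)^-1 * (x, y') \in K by rewrite groupM ?groupV.
  have /(congr1 snd)/= yy' := KN _ Kd (mulVg x).
  by apply: (mulgI y^-1); rewrite mulVg yy'.
have phiM : {in G &, {morph phi0 : x y / x * y}}.
  move=> x y Gx Gy; apply: (Kuniq (x * y)); first exact/phiK/groupM.
  exact: (groupM (phiK x Gx) (phiK y Gy)).
have rphi x : x \in G -> rho (phi0 x) = f (pi x).
  by move=> Gx; have [] := KD _ _ (phiK x Gx).
pose phi := Morphism phiM; exists phi; split=> //.
apply/isomP; split.
  (* If [phi x = 1], then [pi x = 0], so [x = z ^+ p] and [phi z ^+ p = 1]. Hence [phi z], and with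
     it z, has coordinate 0, and [z ^+ p = 1]. *)
  apply/subsetP=> x /morphpreP[Gx /set1P/= phix1]; apply/set1P.
  have x0 : pi x = 0%R.
    by apply/eqP; rewrite -f_eq0 -rphi // phix1 (coord1 cH).
  have [z Gz xE] := coord_ker cG Gx x0; rewrite xE; apply/eqP.
  rewrite (coord_expp cG) // -f_eq0 -rphi // -(coord_expp cH).
    rewrite -[_ == _]/(phi z ^+ p == 1) -morphX // -xE.
    exact/eqP.
  by have [] := KD _ _ (phiK z Gz).
have lift_rho y : y \in H -> exists2 x, x \in G & rho (phi x) = rho y.
  move=> Hy; have [g _ gK] := bij_f.
  have [x Gx pix] := coord_surj cG (g (rho y)).
  by exists x; rewrite // rphi // pix gK.
apply/eqP; rewrite eqEsubset; apply/andP; split; apply/subsetP=> y.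
  by case/morphimP=> x _ Gx ->; have [] := KD _ _ (phiK x Gx).
move=> Hy; have [x Gx rx] := lift_rho y Hy.
have Hphi z : z \in G -> phi z \in H.
  by move=> Gz; have [] := KD _ _ (phiK z Gz).
(* Once [rho y] is matched by some [phi x], the remaining factor lies in the kernel of [rho] and is
   some [w ^+ p]. Replacing w by a [phi v] with the same coordinate does not change the p-th
   power. *)
have [||w Hw yE] := @coord_ker _ _ _ _ _ cH ((phi x)^-1 * y).
- by rewrite groupM ?groupV ?Hphi.
- by rewrite (coordM cH) ?(coordV cH) ?groupV ?Hphi // rx addNr.
have [v Gv rv] := lift_rho w Hw.
have -> : y = phi (x * v ^+ p).
  rewrite morphM ?groupX // morphX //; apply: (canRL (mulKVg _)).
  by rewrite yE; apply/eqP; rewrite (coord_expp_eq odd_p cH) ?Hphi // rv.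
by rewrite mem_morphim ?groupM ?groupX.
Qed.

(** * Algebra isomorphisms induced by group isomorphisms *)

Lemma coord_commE (p : nat) (gT : finGroupType) (G : {group gT})
    (L : algebra 'F_p) (pi : gT -> L) :
    odd p -> coordinatized G pi ->
  {in G & &, forall x y z,
    ([~ x, y] == z ^+ p) = (pi z == alg_mul L (pi x) (pi y))}.
Proof.
move=> odd_p cG x y z Gx Gy Gz.
have [w Gw pw] := coord_surj cG (alg_mul L (pi x) (pi y)).
by rewrite (coord_comm cG Gx Gy Gw pw) (coord_expp_eq odd_p cG) // eq_sym pw.
Qed.

Lemma Fp_scale (p : nat) (V : vectType 'F_p) (a : 'F_p) (x : V) :
  (a *: x = x *+ (a : nat))%R.
Proof. by rewrite -{1}[a]natr_Zp scaler_nat. Qed.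

(** Over the prime field scalar multiples are repeated sums, so the span of the finitely many
    elements of [P] is [P] itself. This turns invariant sets of coordinates into subspaces to which
    irreducibility applies. *)
Lemma Fp_additive_vspace (p : nat) (V : vectType 'F_p) (P : pred V) :
    P 0%R -> {in P &, forall x y, P (x + y)%R} ->
  exists U : {vspace V}, forall v, (v \in U) = P v.
Proof.
move=> P0 PD; pose s := [seq u : V <- enum (finvect_type V) | P u].
have Ps v : v \in s = P v.
  by rewrite mem_filter (mem_enum (finvect_type V)) andbT.
have PX n x : P x -> P (x *+ n)%R.
  by move=> Px; elim: n => [|n IHn] //; rewrite mulrS PD.
exists <<s>>%VS => v; apply/idP/idP=> [/(@coord_span _ _ _ (in_tuple s))->|Pv].
  elim/big_ind: _ => // i _; rewrite Fp_scale.
  by apply: PX; rewrite -Ps mem_nth.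
by rewrite memv_span // Ps.
Qed.

Lemma Fp_additive_linear (p : nat) (V W : vectType 'F_p) (f : V -> W) :
  {morph f : x y / (x + y)%R} -> linear f.
Proof.
move=> fD a x y; rewrite fD; congr (_ + _)%R; rewrite !Fp_scale.
elim: (a : nat) => [|n IHn]; last by rewrite !mulrS fD IHn.
by apply: (addrI (f 0%R)); rewrite -fD !addr0.
Qed.

Lemma alg_AutP (F : finFieldType) (L : algebra F) (a : {perm finvect_type L}) :
  reflect (linear (a : L -> L) /\
           {morph (a : L -> L) : x y / alg_mul L x y})
          (a \in alg_Aut L).
Proof.
rewrite inE; apply: (iffP andP) => [[/forallP la /forallP ma]|[la ma]].
  split=> [c x y|x y]; last exact/eqP/(forallP (ma x)).
  exact/eqP/(forallP (forallP (la c) x)).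
by split; do !apply/forallP=> ?; rewrite ?la ?ma.
Qed.

(** Equal coordinates mean equal p-th powers, so [phi] descends to the algebras. It respects
    products because [coord_commE] expresses them by commutators and p-th powers. *)
Lemma coord_induced (p : nat) (gT hT : finGroupType) (G : {group gT})
    (H : {group hT}) (L M : algebra 'F_p) (pi : gT -> L) (rho : hT -> M)
    (phi : {morphism G >-> hT}) :
    odd p -> coordinatized G pi -> coordinatized H rho -> isom G H phi ->
  exists f : {linear L -> M},
    [/\ bijective f, {morph f : x y / alg_mul L x y >-> alg_mul M x y} &
        {in G, forall x, f (pi x) = rho (phi x)}].
Proof.
move=> odd_p cG cH /isomP[/injmP injphi imphi].
have Hphi x : x \in G -> phi x \in H by move=> Gx; rewrite -imphi mem_morphim.
(* [s] is a section of [pi], not necessarily additive; [fE] shows that the choice does not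
   matter. *)
pose s v := odflt 1 [pick x in G | pi x == v].
have sP v : s v \in G /\ pi (s v) = v.
  rewrite /s; case: pickP => [x /andP[Gx /eqP//]|/=].
  by have [x Gx pix] := coord_surj cG v => /(_ x); rewrite Gx pix eqxx.
have phi_eq : {in G &, forall x y, (rho (phi x) == rho (phi y)) = (pi x == pi y)}.
  move=> x y Gx Gy; rewrite -(coord_expp_eq odd_p cH) ?Hphi //.
  rewrite -(coord_expp_eq odd_p cG) // -!morphX // (inj_in_eq injphi) ?groupX //.
pose f v := rho (phi (s v)).
have fE x : x \in G -> f (pi x) = rho (phi x).
  by move=> Gx; have [Gs es] := sP (pi x); apply/eqP; rewrite phi_eq ?es.
have fD : {morph f : u v / (u + v)%R}.
  move=> u v; have [[Gu {1}<-] [Gv {1}<-]] := (sP u, sP v).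
  by rewrite -(coordM cG) // fE ?groupM // morphM // (coordM cH) ?Hphi.
pose fL : {linear L -> M} :=
  HB.pack f (GRing.isLinear.Build 'F_p L M *:%R f (Fp_additive_linear fD)).
exists fL; split=> //.
  (* The inverse picks an element of [H] above v, pulls it back along [phi] and takes its
     coordinate. *)
  pose g v := pi (invm (introT injmP injphi) (odflt 1 [pick y in H | rho y == v])).
  exists g => [v|v] /=; rewrite /g.
    case: pickP => [y /andP[Hy]|/(_ (phi (s v)))/=]; last first.
      by have [Gs _] := sP v; rewrite Hphi // eqxx.
    move: Hy; rewrite -imphi => /morphimP[x _ Gx ->].
    by have [Gs es] := sP v; rewrite phi_eq // es invmE //= => /eqP.
  case: pickP => [y /andP[Hy /eqP <-]|/=].
    by move: Hy; rewrite -imphi => /morphimP[x _ Gx ->]; rewrite invmE //= fE.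
  by have [y Hy ey] := coord_surj cH v => /(_ y); rewrite Hy ey eqxx.
move=> u v; have [[Gu eu] [Gv ev]] := (sP u, sP v).
have [w Gw ew] := coord_surj cG (alg_mul L u v).
rewrite -[in LHS]ew /= fE //; apply/eqP; rewrite -(coord_commE odd_p cH) ?Hphi //.
rewrite -morphR // -morphX // (inj_in_eq injphi) ?groupR ?groupX //.
by rewrite (coord_commE odd_p cG) // ew eu ev.
Qed.

Lemma coord_aut (p : nat) (gT : finGroupType) (G : {group gT})
    (L : algebra 'F_p) (pi : gT -> L) (phi : {morphism G >-> gT}) :
    odd p -> coordinatized G pi -> isom G G phi ->
  exists2 a, a \in alg_Aut L & {in G, forall x, a (pi x) = pi (phi x)}.
Proof.
move=> odd_p cG isophi.
have [f [/bij_inj f_inj fM fE]] := coord_induced odd_p cG cG isophi.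
exists (perm (f_inj : injective (f : finvect_type L -> finvect_type L))).
  by apply/alg_AutP; split=> [c x y|x y]; rewrite !permE ?linearP ?fM.
by move=> x Gx; rewrite permE fE.
Qed.

Lemma coord_aut_lift (p : nat) (gT : finGroupType) (G : {group gT})
    (L : algebra 'F_p) (pi : gT -> L) (a : {perm finvect_type L}) :
    prime p -> odd p -> coordinatized G pi -> a \in alg_Aut L ->
  exists phi : {morphism G >-> gT},
    isom G G phi /\ {in G, forall x, pi (phi x) = a (pi x)}.
Proof.
move=> p_pr odd_p cG /alg_AutP[la ma].
have [||phi phiP] := @coord_lift _ _ _ _ _ _ _ _ _ (a : L -> L) p_pr odd_p cG cG _ ma.
- by move=> x y; rewrite -[x in LHS]scale1r la scale1r.
- exact: (@injF_bij (finvect_type L) a (@perm_inj _ a)).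
- by exists phi.
Qed.

(** * From irreducible algebras to UCS groups *)

(** The characteristic subgroup is the kernel of [pi], which is also the set of p-th powers. A
    nontrivial proper characteristic H yields two invariant subspaces: the image of H, which must be
    0, and the set of [pi x] with [x ^+ p] in H, which must be all of L. *)
Lemma coord_UCSp2 (p : nat) (gT : finGroupType) (G : {group gT})
    (L : algebra 'F_p) (pi : gT -> L) :
  prime p -> odd p -> coordinatized G pi -> IAC L -> in_UCSp2 p G.
Proof.
move=> p_pr odd_p cG [altL ntL irrL].
have p_powp : {in G, forall x, x ^+ p ^+ p = 1}.
  by move=> x Gx; apply/eqP; rewrite (coord_expp cG) ?groupX // (coord_powp p_pr cG).
have [v v0] : exists v : L, v != 0%R.
  by exists (vpick {:L}); rewrite vpick0.
have [x0 Gx0 pix0] := coord_surj cG v.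
have expG : exponent G = (p ^ 2)%N.
  have : exponent G %| p ^ 2.
    by apply/exponentP=> x Gx; rewrite expnS expn1 expgM p_powp.
  (* Exponent 1 or p would give [x0 ^+ p = 1], hence [v = 0]. *)
  case/(dvdn_pfactor _ _ p_pr) => m; rewrite leq_eqVlt => /predU1P[-> //|m1 eG].
  case/eqP: v0; rewrite -pix0; apply/eqP; rewrite -(coord_expp cG) //.
  move: (expg_exponent Gx0) m1; rewrite eG.
  by case: m {eG} => [|[]] //; rewrite ?expn0 ?expn1 ?expg1 => ->; rewrite ?expg1n.
have pG : p.-group G by rewrite -pnat_exponent expG pnatX pnat_id.
split=> //.
pose P0 := [set x in G | pi x == 0%R].
have gP : group_set P0.
  apply/group_setP; split=> [|x y]; first by rewrite inE group1 (coord1 cG) eqxx.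
  move=> /setIdP[Gx /eqP x1] /setIdP[Gy /eqP y1]; rewrite inE groupM //.
  by rewrite (coordM cG) // x1 y1 addr0 eqxx.
pose P := Group gP.
have PP x : reflect (x \in G /\ pi x = 0%R) (x \in P).
  by apply: (iffP setIdP) => [] [? /eqP].
have PE x : x \in P -> exists2 y, y \in G & x = y ^+ p.
  by case/PP=> Gx; apply: coord_ker.
have powP x : x \in G -> x ^+ p \in P.
  by move=> Gx; apply/PP; rewrite groupX // (coord_powp p_pr cG).
exists P; split.
  split.
  - apply/charP; split=> [|f injf imf]; first by apply/subsetP=> x /PP[].
    have sPG : P \subset G by apply/subsetP=> x /PP[].
    apply/(morphim_fixP injf) => //; apply/subsetP=> _ /morphimP[x Gx Px ->].
    have [y Gy ->] := PE x Px; rewrite morphX // powP //.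
    by have := mem_morphim f Gy Gy; rewrite imf.
  - apply/eqP=> P1; have : x0 ^+ p \in P by apply: powP.
    by move/eqP: P1 => /eqP ->; rewrite inE (coord_expp cG) // pix0 (negPf v0).
  - apply/properP; split; first by apply/subsetP=> x /PP[].
    by exists x0 => //; apply/negP=> /PP[_ /eqP]; rewrite pix0 (negPf v0).
move=> H [chH ntH prH]; have sHG := char_sub chH.
have lift a : a \in alg_Aut L -> exists phi : {morphism G >-> gT},
    [/\ phi @* G = G, phi @* H = H & {in G, forall x, pi (phi x) = a (pi x)}].
  move=> Aa; have [phi [/isomP[injphi imphi] phiE]] := coord_aut_lift p_pr odd_p cG Aa.
  by exists phi; split=> //; case/charP: chH => _; apply.
have sHP : H \subset P.
  have [||U UE] := @Fp_additive_vspace _ L (fun v => [exists x in H, pi x == v]).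
  - by apply/exists_inP; exists 1; rewrite ?(coord1 cG).
  - move=> u w /exists_inP[x Hx /eqP<-] /exists_inP[y Hy /eqP<-].
    by apply/exists_inP; exists (x * y); rewrite ?groupM // (coordM cG) ?(subsetP sHG).
  have [|U0|U1] := irrL U.
  - move=> a /lift[phi [phiG phiH phiE]] u; rewrite !UE => /exists_inP[x Hx /eqP<-].
    apply/exists_inP; exists (phi x); last by rewrite phiE ?(subsetP sHG).
    by have := mem_morphim phi (subsetP sHG x Hx) Hx; rewrite phiH.
  - apply/subsetP=> x Hx; apply/PP; rewrite (subsetP sHG) //; split=> //.
    apply/eqP; rewrite -memv0 -U0 UE; apply/exists_inP; by exists x.
  (* If H maps onto L, it contains some h with the coordinate of x, and [h^-1 * x] is some [y ^+ p].
     As y has the coordinate of some k in H, this equals [k ^+ p], and x lies in H. *)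
  case/negP: (proper_subn prH); apply/subsetP=> x Gx.
  have lifted y : y \in G -> exists2 h, h \in H & pi h = pi y.
    have := memvf (pi y); rewrite -U1 UE => /exists_inP[h Hh /eqP hy] _.
    by exists h.
  have [h Hh hx] := lifted x Gx; have Gh := subsetP sHG _ Hh.
  have [||y Gy hy] := @coord_ker _ _ _ _ _ cG (h^-1 * x).
  - by rewrite groupM ?groupV.
  - by rewrite (coordM cG) ?(coordV cG) ?groupV // hx addNr.
  have [k Hk ky] := lifted y Gy.
  rewrite -(mulKVg h x) hy groupM //.
  have /eqP <- : k ^+ p == y ^+ p.
    by rewrite (coord_expp_eq odd_p cG) ?ky // (subsetP sHG).
  by rewrite groupX.
apply/val_inj/eqP; rewrite eqEsubset sHP andbT /=.
have [||U UE] := @Fp_additive_vspace _ L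
  (fun v => [exists x in G, (pi x == v) && (x ^+ p \in H)]).
- by apply/exists_inP; exists 1; rewrite ?(coord1 cG) ?expg1n ?eqxx ?group1.
- move=> u w /exists_inP[x Gx /andP[/eqP<- Hx]] /exists_inP[y Gy /andP[/eqP<- Hy]].
  apply/exists_inP; exists (x * y); rewrite ?groupM // (coordM cG) // eqxx.
  by rewrite (coord_expMp odd_p cG) ?groupM.
have [|U0|U1] := irrL U.
- move=> a /lift[phi [phiG phiH phiE]] u; rewrite !UE.
  case/exists_inP=> x Gx /andP[/eqP<- Hx].
  apply/exists_inP; exists (phi x); last first.
    rewrite phiE // eqxx -morphX //.
    by have := mem_morphim phi (groupX p Gx) Hx; rewrite phiH.
  by have := mem_morphim phi Gx Gx; rewrite phiG.
(* Each h in H is some [y ^+ p] with [pi y] in [U], so [U = 0] would make H trivial. *)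
- case/negP: ntH; rewrite -subG1; apply/subsetP=> h Hh; apply/set1P.
  have [y Gy hy] := PE h (subsetP sHP h Hh).
  rewrite hy; apply/eqP; rewrite (coord_expp cG) // -memv0 -U0 UE.
  by apply/exists_inP; exists y; rewrite // eqxx -hy.
apply/subsetP=> x /PE[y Gy ->].
have := memvf (pi y); rewrite -U1 UE => /exists_inP[h Gh /andP[/eqP hy]].
suff /eqP-> : h ^+ p == y ^+ p by [].
by rewrite (coord_expp_eq odd_p cG) // hy.
Qed.

(** * Coordinates on a UCS group from its Frattini quotient *)

Section FrattiniCoordinates.

Variables (p : nat) (odd_p : odd p) (G : UCSp2 p).
Local Notation L := (Frattini_algebra odd_p G).
Local Notation bar := (@Frattini_bar p G : UCS_type G -> L).

Lemma Frattini_bar_eq0 x : x \in G -> (bar x == 0%R) = (x \in 'Phi(G)).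
Proof.
move=> Gx; rewrite -UCS_ker_powp //.
have bar1 : bar 1 = 0%R.
  by apply: val_inj; rewrite /Frattini_bar coset_id ?group1 //= subgK.
by rewrite -(inj_eq (@pth_power_inj _ odd_p G)) -bar1 !pth_power_bar ?group1 ?expg1n.
Qed.

(** On G the subgroup ['Phi(G)] is at once the kernel of [bar], the kernel of p-th powering and its
    image. *)
Lemma Frattini_coordinatized : coordinatized G bar.
Proof.
split.
- by move=> x y; apply: Frattini_barM.
- by move=> v; exists (Frattini_lift v); rewrite ?Frattini_liftG ?Frattini_barK.
- by move=> x Gx; rewrite Frattini_bar_eq0 // UCS_ker_powp.
- move=> x Gx /eqP; rewrite Frattini_bar_eq0 // -UCS_im_powp // => /imsetP[y Gy ->].
  by exists y.
move=> x y z Gx Gy Gz; rewrite /= Frattini_mul_bar // => ez.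
by rewrite -pth_power_bar // ez pth_rootK // UCS_comm_Phi.
Qed.

(** Coordinates on any copy of G determine its algebra. This recognises the algebra of a group built
    by other means without computing its Frattini quotient. *)
Lemma Frattini_algebra_isom (gT : finGroupType) (H : {group gT}) (M : algebra 'F_p)
    (rho : gT -> M) :
  coordinatized H rho -> G \isog H -> alg_isom L M.
Proof.
move=> cH /isogP[phi injphi imphi].
have isophi := introT isomP (conj injphi imphi).
have [f [bij_f fM _]] := coord_induced odd_p Frattini_coordinatized cH isophi.
by exists f.
Qed.

(** The correspondence behind (b) and (c), taken from subspaces to subgroups. *)
Definition Frattini_preim (U : {vspace L}) : {set UCS_type G} :=
  [set x in G | bar x \in U].

Lemma Frattini_preim_sub U : Frattini_preim U \subset G.
Proof. by apply/subsetP=> x /setIdP[]. Qed.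

Lemma Frattini_preim_group_set U : group_set (Frattini_preim U).
Proof.
have cG := Frattini_coordinatized.
apply/group_setP; split=> [|x y].
  by rewrite inE group1 (coord1 cG) mem0v.
move=> /setIdP[Gx Ux] /setIdP[Gy Uy].
by rewrite inE groupM // (coordM cG) // memvD.
Qed.
Canonical Frattini_preim_group U := Group (Frattini_preim_group_set U).

Lemma Frattini_Phi_preim U : 'Phi(G) \subset Frattini_preim U.
Proof.
apply/subsetP=> x Px; have Gx := subsetP (Phi_sub G) x Px.
by move: Px; rewrite inE Gx -Frattini_bar_eq0 // => /eqP->; rewrite mem0v.
Qed.

(** Automorphisms of G act on L by algebra automorphisms, so the preimage of an invariant subspace
    is characteristic. It contains ['Phi(G)], which is nontrivial, so it is ['Phi(G)] or G, and the
    subspace is 0 or L. *)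
Lemma Frattini_algebra_IAC : IAC L.
Proof.
have cG := Frattini_coordinatized.
have p_pr := UCS_prime G.
split=> [u | | U invU].
- have [x Gx <-] := coord_surj cG u; apply/eqP; rewrite eq_sym.
  by rewrite -(coord1 cG) -(coord_commE odd_p cG) // commgg expg1n.
- have /andP[_ /subsetPn[x Gx Phi'x]] := UCS_Phi_proper G.
  apply: contraNneq Phi'x => L0.
  by rewrite -Frattini_bar_eq0 // -memv0 -L0 memvf.
have chK : Frattini_preim_group U \char G.
  have sKG := Frattini_preim_sub U.
  apply/charP; split=> // f injf imf; apply/(morphim_fixP injf) => //.
  apply/subsetP=> _ /morphimP[x Gx /setIdP[_ Ux] ->].
  have [a Aa aE] := coord_aut odd_p cG (introT isomP (conj injf imf)).
  rewrite inE -aE // invU //.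
  by have := mem_morphim f Gx Gx; rewrite imf => ->.
case: (UCS_char chK) => /= eK.
- by case/negP: (UCS_Phi_neq1 G); rewrite -subG1 -eK Frattini_Phi_preim.
- left; apply/eqP; rewrite -subv0; apply/subvP=> u Uu.
  have [x Gx ux] := coord_surj cG u; rewrite -ux in Uu *.
  by rewrite memv0 Frattini_bar_eq0 // -eK inE Gx.
right; apply/vspaceP=> u; rewrite memvf; have [x Gx <-] := coord_surj cG u.
by move: Gx; rewrite -eK => /setIdP[].
Qed.

Lemma Frattini_preim_inj U V : Frattini_preim_group U = Frattini_preim_group V -> U = V.
Proof.
move=> [eUV]; apply/vspaceP=> u.
have [x Gx <-] := coord_surj Frattini_coordinatized u.
by move/setP/(_ x): eUV; rewrite !inE Gx.
Qed.

Lemma Frattini_preim_surj (H : {group UCS_type G}) :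
  'Phi(G) \subset H -> H \subset G -> exists U, Frattini_preim_group U = H.
Proof.
have cG := Frattini_coordinatized; move=> sPH sHG.
have [||U UE] := @Fp_additive_vspace _ L (fun v => [exists x in H, bar x == v]).
- by apply/exists_inP; exists 1; rewrite ?(coord1 cG).
- move=> u w /exists_inP[x Hx /eqP<-] /exists_inP[y Hy /eqP<-].
  by apply/exists_inP; exists (x * y); rewrite ?groupM // (coordM cG) ?(subsetP sHG).
exists U; apply: val_inj; apply/setP=> x /=; rewrite inE UE.
apply/andP/idP=> [[Gx /exists_inP[y Hy /eqP xy]]|Hx]; last first.
  by rewrite (subsetP sHG) //; split=> //; apply/exists_inP; exists x.
have Gy := subsetP sHG y Hy; rewrite -(groupMl x (groupVr Hy)) (subsetP sPH) //.
rewrite -Frattini_bar_eq0 ?groupM ?groupV // (coordM cG) ?groupV //.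
by rewrite (coordV cG) // xy addNr.
Qed.

(** * Powerful subgroups, subalgebras and ideals *)

(** As p-th powering is multiplicative on G, the p-th powers of a subgroup already form a
    subgroup. *)
Lemma ppowersP (H : {group UCS_type G}) x :
  H \subset G -> reflect (exists2 y, y \in H & x = y ^+ p) (x \in ppowers p H).
Proof.
move=> sHG; have -> : ppowers p H = expgn^~ p @: H.
  apply/eqP; rewrite eqEsubset subset_gen andbT.
  have gH : group_set (expgn^~ p @: H).
    apply/group_setP; split=> [|_ _ /imsetP[y Hy ->] /imsetP[z Hz ->]].
      by apply/imsetP; exists 1; rewrite ?group1 ?expg1n.
    apply/imsetP; exists (y * z); rewrite ?groupM //.
    by rewrite UCS_expMp ?(subsetP sHG).
  by rewrite -[_ @: _]/(gval (Group gH)) gen_subG.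
by apply: (iffP imsetP).
Qed.

(** By [coord_commE], [[~ x, y] = z ^+ p] says that [bar z] is the product of [bar x] and [bar y];
    so z can be taken in the preimage exactly when this product lies in [U]. *)
Lemma Frattini_powerfulP U :
  reflect (subalgebra U) (powerful p (Frattini_preim_group U)).
Proof.
have cG := Frattini_coordinatized.
have sHG := Frattini_preim_sub U.
apply: (iffP idP) => [/subsetP pH u v Uu Uv|subU].
  have [[x Gx ux] [y Gy vy]] := (coord_surj cG u, coord_surj cG v).
  rewrite -ux in Uu *; rewrite -vy in Uv *.
  have : [~ x, y] \in (Frattini_preim_group U)^`(1).
    by rewrite mem_commg // inE ?Gx ?Gy.
  move/pH/(ppowersP _ sHG) => [z Hz /eqP]; have /setIdP[Gz Uz] := Hz.
  by rewrite (coord_commE odd_p cG) // => /eqP<-.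
rewrite /powerful gen_subG; apply/subsetP=> _ /imset2P[x y Hx Hy ->].
have [/setIdP[Gx Ux] /setIdP[Gy Uy]] := (Hx, Hy).
have [z Gz ez] := coord_surj cG (alg_mul L (bar x) (bar y)).
apply/(ppowersP _ sHG); exists z; last exact: (coord_comm cG).
by rewrite inE Gz ez subU.
Qed.

Lemma Frattini_powerfully_embeddedP U :
  reflect (ideal U) (powerfully_embedded p (Frattini_preim_group U) G).
Proof.
have cG := Frattini_coordinatized.
have sHG := Frattini_preim_sub U.
rewrite /powerfully_embedded sHG /=.
apply: (iffP idP) => [/subsetP pH u v Uu|idU].
  have [[x Gx ux] [y Gy vy]] := (coord_surj cG u, coord_surj cG v).
  rewrite -ux in Uu *; rewrite -vy.
  have : [~ x, y] \in [~: Frattini_preim_group U, G].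
    by rewrite mem_commg // inE Gx.
  move/pH/(ppowersP _ sHG) => [z Hz exy]; have /setIdP[Gz Uz] := Hz.
  have /eqP := exy; rewrite (coord_commE odd_p cG) // => /eqP<-; split=> //.
  (* The product in the other order comes from the inverse commutator, which is the p-th power of
     [z^-1]. *)
  have /eqP : [~ y, x] = z^-1 ^+ p by rewrite -invg_comm exy expgVn.
  rewrite (coord_commE odd_p cG) ?groupV // => /eqP<-.
  by rewrite (coordV cG) ?memvN.
rewrite gen_subG; apply/subsetP=> _ /imset2P[x y Hx Gy ->].
have /setIdP[Gx Ux] := Hx.
have [z Gz ez] := coord_surj cG (alg_mul L (bar x) (bar y)).
apply/(ppowersP _ sHG); exists z; last exact: (coord_comm cG).
by rewrite inE Gz ez; have [] := idU _ (bar y) Ux.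
Qed.

(** * Automorphisms modulo central automorphisms *)

(** For abelian G the centre is G and every automorphism is central, so the quotient by [Aut_C G] is
    trivial. Otherwise the centre is the kernel of [bar], and central automorphisms are those acting
    trivially on L. *)
Lemma nonabelian_UCS_center : ~~ abelian G -> 'Z(G) = 'Phi(G).
Proof.
move=> nabG; case: (UCS_char (center_char G)) => //= eZ.
  have := UCS_Phi_central G; rewrite /= eZ => sP1.
  by case/negP: (UCS_Phi_neq1 G); rewrite -subG1.
by case/negP: nabG; apply/center_idP.
Qed.

(** [Aut G] acts on L, and maps onto [alg_Aut L] since algebra automorphisms lift. The kernel fixes
    every coset of ['Phi(G)], which is the centre. *)
Lemma Aut_quotient_Aut_C : ~~ abelian G -> Aut G / Aut_C G \isog alg_Aut L.
Proof.
move/nonabelian_UCS_center=> ZG; have cG := Frattini_coordinatized.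
have p_pr := UCS_prime G.
(* At most one permutation is compatible with [bar], which is onto; for a in [Aut G] one exists, so
   the default 1 is not reached there. *)
pose A0 (a : {perm UCS_type G}) : {perm finvect_type L} :=
  odflt 1 [pick b in alg_Aut L | [forall x in G, b (bar x) == bar (a x)]].
have A0P a : a \in Aut G ->
    A0 a \in alg_Aut L /\ {in G, forall x, A0 a (bar x) = bar (a x)}.
  move=> Aa; rewrite /A0; case: pickP => [b /andP[Ab /forall_inP bE]|/=].
    by split=> // x Gx; apply/eqP/bE.
  have isoa := introT isomP (conj (injm_autm Aa) (im_autm Aa)).
  have [b Ab bE] := coord_aut odd_p cG isoa.
  move=> /(_ b); rewrite Ab => /forall_inP[] x Gx.
  by rewrite bE.
have eq_A (b c : {perm finvect_type L}) :
    {in G, forall x, b (bar x) = c (bar x)} -> b = c.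
  move=> ebc; apply/permP=> u; have [x Gx <-] := coord_surj cG (u : L).
  exact: ebc.
have A0M : {in Aut G &, {morph A0 : a b / a * b}}.
  move=> a b Aa Ab; apply: eq_A => x Gx.
  have Gax : a x \in G by rewrite Aut_closed.
  have [[[_ aE] [_ bE]] [_ abE]] := (A0P a Aa, A0P b Ab, A0P _ (groupM Aa Ab)).
  rewrite (abE x Gx) (permM a b).
  rewrite -(bE _ Gax) -(aE x Gx).
  by rewrite [RHS]permM.
pose A := Morphism A0M.
suff [<- <-] : 'ker A = Aut_C G /\ A @* Aut G = alg_Aut L by exact: first_isog.
split; apply/setP=> a.
  have kerE : a \in Aut G ->
      {in G, forall x, (coset 'Z(G) (a x) == coset 'Z(G) x) = (bar (a x) == bar x)}.
    move=> Aa x Gx; have Gax : a x \in G by rewrite Aut_closed.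
    have nZ := subsetP (char_norm (center_char G)).
    apply/eqP/eqP=> [/rcoset_kercosetP|exx].
      rewrite !nZ // => /(_ isT isT) /rcosetP[z Zz ->].
      have Pz : z \in 'Phi(G) by rewrite -ZG.
      have Gz := subsetP (Phi_sub G) z Pz.
      rewrite (coordM cG) //; move: Pz; rewrite -Frattini_bar_eq0 // => /eqP->.
      exact: add0r.
    apply/rcoset_kercosetP; rewrite ?nZ //; apply/rcosetP.
    exists (a x * x^-1); last by rewrite mulgKV.
    have -> : 'Z(G)%G = 'Phi(G)%G :> {set _} by [].
    rewrite -Frattini_bar_eq0 ?groupM ?groupV // (coordM cG) ?groupV //.
    by rewrite (coordV cG) // exx subrr.
  apply/idP/setIdP=> [kAa|[Aa /forall_inP cAa]].
    have Aa := dom_ker kAa.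
    split=> //; apply/forall_inP=> x Gx; rewrite kerE //.
    by rewrite -(A0P a Aa).2 // -[A0 a]/(A a) (mker kAa) perm1.
  apply/(kerP A Aa)/eq_A=> x Gx; rewrite (A0P a Aa).2 // perm1.
  by apply/eqP; rewrite -kerE // cAa.
apply/morphimP/idP=> [[b _ Ab ->]|Aa]; first by have [] := A0P b Ab.
have [phi [/isomP[injphi imphi] phiE]] := coord_aut_lift p_pr odd_p cG Aa.
exists (aut injphi imphi) => //; rewrite ?Aut_aut //.
apply: eq_A => x Gx; have [_ ->] := A0P _ (Aut_aut injphi imphi) => //.
by rewrite autE // phiE.
Qed.

End FrattiniCoordinates.

(** * Twisting the addition of an abelian group *)

Lemma Fp_two_neq0 (p : nat) : prime p -> odd p -> (2%:R != 0 :> 'F_p)%R.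
Proof.
move=> p_pr odd_p; rewrite -(dvdn_pcharf (pchar_Fp p_pr)).
by rewrite dvdn_prime2 //; apply: contraTneq odd_p => ->.
Qed.

(** Conditions making [x + y + beta x y] a group law. Since [beta] vanishes as soon as one argument
    is a value of [beta], the group has nilpotency class at most 2. *)
Definition nil2_biadditive (A : zmodType) (beta : A -> A -> A) : Prop :=
  [/\ forall z, {morph beta^~ z : x y / (x + y)%R},
      forall z, {morph beta z : x y / (x + y)%R},
      forall x y z, beta (beta x y) z = 0%R &
      forall x y z, beta x (beta y z) = 0%R].

Section TwistedGroup.

Variables (A : finZmodType) (beta : A -> A -> A) (nb : nil2_biadditive beta).

(** The phantom argument carries the proof that [beta] is admissible, so that the group structure
    can be attached to this copy of [A]. *)
Definition twisted (_ : nil2_biadditive beta) : Type := A.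
Local Notation T := (twisted nb).

Definition twisted_mul (x y : A) : A := (x + y + beta x y)%R.
Definition twisted_inv (x : A) : A := (beta x x - x)%R.

Lemma nil2_0l x : beta 0%R x = 0%R.
Proof. by case: nb => D _ _ _; apply: (addrI (beta 0%R x)); rewrite -D !addr0. Qed.

Lemma nil2_0r x : beta x 0%R = 0%R.
Proof. by case: nb => _ D _ _; apply: (addrI (beta x 0%R)); rewrite -D !addr0. Qed.

Lemma twisted_mulA : associative twisted_mul.
Proof.
case: nb => Dl Dr bl br x y z; rewrite /twisted_mul !(Dl, Dr) bl br !addr0 -!addrA.
by do 2![congr (_ + _)%R]; rewrite [RHS]addrCA; congr (_ + _)%R; rewrite addrC addrA.
Qed.

Lemma twisted_mul0 : left_id 0%R twisted_mul.
Proof. by move=> x; rewrite /twisted_mul nil2_0l addr0 add0r. Qed.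

Lemma twisted_mulN : left_inverse 0%R twisted_inv twisted_mul.
Proof.
case: nb => Dl Dr bl br x; rewrite /twisted_mul /twisted_inv subrK Dl bl add0r -Dl.
by rewrite subrr nil2_0l.
Qed.

HB.instance Definition _ := Finite.copy T A.
HB.instance Definition _ :=
  Finite_isGroup.Build T twisted_mulA twisted_mul0 twisted_mulN.

Lemma twisted_mulE (x y : T) : x * y = (x + y + beta x y)%R.
Proof. by []. Qed.

Lemma twisted_expE n (x : T) : beta x x = 0%R -> x ^+ n = (x *+ n : A)%R.
Proof.
case: nb => Dl Dr bl br x0; elim: n => // n IHn.
rewrite expgS IHn twisted_mulE mulrS.
have -> : beta x (x *+ n : A)%R = 0%R.
  by elim: n {IHn} => [|n IHn]; rewrite ?nil2_0r // mulrS Dr IHn x0 addr0.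
by rewrite addr0.
Qed.

End TwistedGroup.

(* The commutator of x and y for x + y + beta x y is 2 beta x y, hence the factor
   one half in beta. *)
Section TwistedCoordinates.

Variables (p : nat) (p_pr : prime p) (odd_p : odd p) (L : algebra 'F_p).
Hypothesis altL : forall x : L, alg_mul L x x = 0%R.
Variables (A : finZmodType) (pi : A -> L) (s : L -> A).
Hypothesis piD : {morph pi : x y / (x + y)%R}.
Hypothesis sK : cancel s pi.
Hypothesis pi_p : forall a, (a *+ p == 0)%R = (pi a == 0%R).
Hypothesis pi_ker : forall a, pi a = 0%R -> exists b, a = (b *+ p)%R.

Let half : 'F_p := (2%:R)^-1%R.
Let beta (x y : A) : A := (s (half *: alg_mul L (pi x) (pi y)) *+ p)%R.

Let pi0 : pi 0%R = 0%R.
Proof. by apply: (addrI (pi 0%R)); rewrite -piD !addr0. Qed.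

Let piMn n x : (pi (x *+ n) = pi x *+ n)%R.
Proof. by elim: n => [|n IHn]; rewrite ?mulr0n ?pi0 // !mulrS piD IHn. Qed.

Let pi_powp x : pi (x *+ p)%R = 0%R.
Proof. by rewrite piMn -scaler_nat pchar_Fp_0 // scale0r. Qed.

(** This makes [beta] independent of the section [s], which need not be additive. *)
Let powp_eq x y : pi x = pi y -> (x *+ p = y *+ p)%R.
Proof.
move=> exy; apply/eqP; rewrite -subr_eq0 -mulrnBl pi_p.
apply/eqP/(addIr (pi y)); rewrite -piD subrK add0r exy //.
Qed.

Let beta_eq0 x : beta x x = 0%R.
Proof. by apply/eqP; rewrite pi_p sK altL scaler0. Qed.

(** Values of [beta] are multiples of p, so [pi] kills them and [beta] vanishes on them. *)
Lemma twisting_nil2 : nil2_biadditive beta.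
Proof.
rewrite /beta; split=> [z x y|z x y|x y z|x y z].
- rewrite -mulrnDl; apply: powp_eq.
  by rewrite !piD !sK linearDl scalerDr.
- rewrite -mulrnDl; apply: powp_eq.
  by rewrite !piD !sK linearDr scalerDr.
- by apply/eqP; rewrite pi_p sK pi_powp linear0l scaler0.
by apply/eqP; rewrite pi_p sK pi_powp linear0r scaler0.
Qed.

Let twisting_comm (x y z : A) : pi z = alg_mul L (pi x) (pi y) ->
  (x + y + beta x y = y + x + beta y x + z *+ p)%R.
Proof.
move=> ez; rewrite -[RHS]addrA [in RHS](addrC y); congr (_ + _)%R.
rewrite /beta -mulrnDl; apply: powp_eq; rewrite piD !sK ez.
have -> : alg_mul L (pi y) (pi x) = (- alg_mul L (pi x) (pi y))%R.
  apply/eqP; rewrite -addr_eq0; have := altL (pi x + pi y)%R.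
  by rewrite linearDl !linearDr !altL add0r addr0 addrC => ->.
have half2 : (half + half = 1)%R.
  rewrite -[half]mulr1 -mulrDr -[(1 + 1)%R]/(2%:R)%R mulVf //.
  exact: Fp_two_neq0.
set m := alg_mul L _ _.
by rewrite scalerN -[X in (_ + X)%R]scale1r -half2 scalerDl addKr.
Qed.

Lemma twisted_coordinatized :
  coordinatized [set: twisted twisting_nil2] (pi : twisted twisting_nil2 -> L).
Proof.
have [Dl Dr bl br] := twisting_nil2.
have expE (x : twisted twisting_nil2) : x ^+ p = (x *+ p : A)%R.
  by rewrite twisted_expE // beta_eq0.
split=> [x y _ _|v|x _|x _ /pi_ker[b ->]|x y z _ _ _ ez].
- by rewrite twisted_mulE !piD pi_powp addr0.
- by exists (s v); [apply: in_setT | apply: sK].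
- by rewrite expE; apply: pi_p.
- by exists b; [apply: in_setT | rewrite expE].
(* The claim becomes [x * y = y * x * z ^+ p], where the last product is a plain sum because [beta]
   vanishes on multiples of p. *)
apply: (mulgI (y * x)); rewrite -commgC expE !twisted_mulE.
have -> : beta (y + x + beta y x)%R (z *+ p)%R = 0%R.
  by apply/eqP; rewrite pi_p sK pi_powp linear0r scaler0.
rewrite addr0; exact: twisting_comm.
Qed.

End TwistedCoordinates.

(** * Reduction from Z/p^2 to the prime field *)

Section ZpSquare.
Variables (p : nat) (p_pr : prime p).
Local Notation Q := 'Z_(p ^ 2).
Local Notation red := (fun a : Q => (nat_of_ord a)%:R : 'F_p)%R.

Let q_gt1 : 1 < p ^ 2.
Proof. by rewrite (ltn_exp2l 0) ?prime_gt1. Qed.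

Let red_mod m : ((m %% p ^ 2)%:R = m%:R :> 'F_p)%R.
Proof.
rewrite [in RHS](divn_eq m (p ^ 2)) natrD natrM natrX pchar_Fp_0 //.
by rewrite expr0n mulr0 add0r.
Qed.

Let red_nat m : red m%:R%R = (m%:R)%R.
Proof. by rewrite /= val_Zp_nat // red_mod. Qed.

Lemma redD : {morph red : a b / (a + b)%R}.
Proof.
by move=> a b; have := red_nat (a + b)%N; rewrite /= !natrD !natr_Zp.
Qed.

Lemma red_eq0 a : (red a == 0%R) = (p %| a).
Proof. by rewrite -(dvdn_pcharf (pchar_Fp p_pr)). Qed.

Lemma Zp2_powp (a : Q) : (a *+ p == 0)%R = (red a == 0%R).
Proof.
rewrite red_eq0 -[a in LHS]natr_Zp -mulrnA -(inj_eq val_inj) /=.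
rewrite val_Zp_nat //.
rewrite -[_ == _]/(p ^ 2 %| a * p) -[X in X %| _]mulnn dvdn_pmul2r ?prime_gt0 //.
Qed.

Lemma red_ker (a : Q) : red a = 0%R -> exists b : Q, a = (b *+ p)%R.
Proof.
move/eqP; rewrite red_eq0 => /dvdnP[k ak]; exists (k%:R)%R.
by rewrite -[a in LHS]natr_Zp ak natrM mulr_natr.
Qed.

Lemma red_lift (c : 'F_p) : red (c : nat)%:R%R = c.
Proof. by have := red_nat c; rewrite /= natr_Zp. Qed.

End ZpSquare.

Import VectorInternalTheory.

(** The abelian group is (Z/p^2)^n with n the dimension of L. [pi] reduces entries modulo p and
    reads them as coordinates in a basis of L; [s] lifts each coordinate to its representative below
    p. *)
Lemma coordinatized_exists (p : nat) (L : algebra 'F_p) :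
    prime p -> odd p -> (forall x : L, alg_mul L x x = 0%R) ->
  exists (gT : finGroupType) (G : {group gT}) (pi : gT -> L), coordinatized G pi.
Proof.
move=> p_pr odd_p altL; pose n := dim L.
pose A : finZmodType := 'rV['Z_(p ^ 2)]_n.
pose pi (x : A) : L :=
  @r2v _ L (map_mx (fun a : 'Z_(p ^ 2) => (a : nat)%:R : 'F_p)%R x).
pose s (v : L) : A := map_mx (fun c : 'F_p => (c : nat)%:R : 'Z_(p ^ 2))%R (v2r v).
have pi_eq0 x : pi x = 0%R -> forall i, ((x 0 i : nat)%:R = 0 :> 'F_p)%R.
  move=> x0 i; have /(congr1 v2r) := x0; rewrite r2vK linear0 => /rowP/(_ i).
  by rewrite !mxE.
do 3![eexists]; apply: (@twisted_coordinatized p p_pr odd_p L altL A pi s).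
- move=> x y; rewrite /pi -linearD; congr r2v; apply/rowP=> i.
  by rewrite !mxE redD.
- move=> v; rewrite /pi /s -[RHS]v2rK; congr r2v; apply/rowP=> i.
  by rewrite !mxE red_lift.
- move=> x; apply/eqP/eqP=> [xp0|/pi_eq0 x0].
    rewrite /pi; apply: (canLR v2rK); rewrite linear0; apply/rowP=> i.
    rewrite !mxE; apply/eqP; rewrite -Zp2_powp //.
    by move/rowP/(_ i): xp0; rewrite mulmxnE mxE => ->.
  by apply/rowP=> i; rewrite mulmxnE mxE; apply/eqP; rewrite Zp2_powp // x0.
move=> x /pi_eq0 x0.
have H i : exists b : 'Z_(p ^ 2), x 0%R i == (b *+ p)%R.
  by have [b xb] := red_ker p_pr (x0 i); exists b; apply/eqP.
exists (\row_i xchoose (H i))%R; apply/rowP=> i.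
by rewrite mulmxnE mxE; apply/eqP/(xchooseP (H i)).
Qed.

(** * Direct powers of groups and algebras *)

Lemma alg_Aut0 (F : finFieldType) (L : algebra F) (a : {perm finvect_type L}) :
  a \in alg_Aut L -> a (0%R : L) = 0%R :> L.
Proof.
move=> /alg_AutP[la _]; apply: (addrI (a (0%R : L) : L)); rewrite addr0.
by have := la 1%R (0%R : L) (0%R : L); rewrite !scale1r addr0 => <-.
Qed.

Lemma alg_pow_coordinatized (p : nat) (gT : finGroupType) (G : {group gT})
    (L : algebra 'F_p) (pi : gT -> L) (k : nat) :
    coordinatized G pi ->
  coordinatized (direct_power G k)
    (fun x => [ffun i => pi (x i)] : alg_pow L k).
Proof.
move=> cG; have expE n (x : {dffun forall i : 'I_k, gT}) i : (x ^+ n) i = x i ^+ n.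
  by elim: n => [|n IHn]; rewrite ?oneg_ffun // !expgS mulg_ffun IHn.
split.
- move=> x y /setXnP Gx /setXnP Gy; apply/ffunP=> i.
  by rewrite !ffunE (coordM cG).
- move=> v; have piv i : exists x, (x \in G) && (pi x == v i).
    by have [x Gx ex] := coord_surj cG (v i); exists x; rewrite Gx ex /=.
  exists [ffun i => xchoose (piv i)].
    by apply/setXnP=> i; rewrite ffunE; have /andP[] := xchooseP (piv i).
  apply/ffunP=> i; rewrite !ffunE; have /andP[_ /eqP] := xchooseP (piv i) => //.
- move=> x /setXnP Gx; apply/eqP/eqP=> /ffunP xp; apply/ffunP=> i.
    have := xp i; rewrite expE !ffunE => /eqP; rewrite (coord_expp cG) //.
    by move/eqP.
  have := xp i; rewrite expE !ffunE => xi0.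
  by apply/eqP; rewrite (coord_expp cG) // xi0.
- move=> x /setXnP Gx /ffunP x0.
  have powx i : exists y, (y \in G) && (x i == y ^+ p).
    have := x0 i; rewrite !ffunE => /(coord_ker cG (Gx i))[y Gy ->].
    by exists y; rewrite Gy /=.
  exists [ffun i => xchoose (powx i)].
    by apply/setXnP=> i; rewrite ffunE; have /andP[] := xchooseP (powx i).
  apply/ffunP=> i; rewrite expE ffunE; have /andP[_ /eqP] := xchooseP (powx i) => //.
move=> x y z /setXnP Gx /setXnP Gy /setXnP Gz /ffunP ez; apply/ffunP=> i.
have := ez i; rewrite expE /commg /conjg !(mulg_ffun, invg_ffun) !ffunE.
exact: (coord_comm cG).
Qed.

(** If every automorphism fixed w, the line through w would be invariant, hence all of L. Then the
    product is zero, and negation is an automorphism that moves w because p is odd. *)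
Lemma IAC_alg_Aut_moves (p : nat) (L : algebra 'F_p) (w : L) :
    prime p -> odd p -> IAC L -> w != 0%R ->
  exists2 a, a \in alg_Aut L & (a w : L) != w.
Proof.
move=> p_pr odd_p [altL ntL irrL] w0.
have [/existsP[a /andP[Aa aw]]|/existsPn fix_w] :=
  boolP [exists a, (a \in alg_Aut L) && ((a w : L) != w)]; first by exists a.
have [a Aa u /vlineP[c ->]|w_0|w_full] := irrL <[w]>%VS.
- have /alg_AutP[la _] := Aa.
  have := fix_w a; rewrite Aa /= negbK => /eqP aw.
  have := la c w 0%R; rewrite !addr0 (alg_Aut0 Aa) addr0 aw => ->.
  by rewrite memvZ ?memv_line.
- by case/eqP: w0; apply/eqP; rewrite -memv0 -w_0 memv_line.
have mul0 (x y : L) : alg_mul L x y = 0%R.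
  have [/vlineP[c ->] /vlineP[d ->]] : x \in <[w]>%VS /\ y \in <[w]>%VS.
    by rewrite w_full !memvf.
  by rewrite linearZl_LR linearZr_LR altL /= !scaler0.
pose opp (x : finvect_type L) : finvect_type L := (- x)%R.
have oppA : perm (@oppr_inj L : injective opp) \in alg_Aut L.
  apply/alg_AutP; split=> [c x y|x y]; rewrite !permE /opp ?mul0 ?oppr0 //.
  by rewrite opprD scalerN.
have := fix_w (perm (@oppr_inj L : injective opp)).
rewrite oppA /= negbK permE /opp eq_sym -addr_eq0 -mulr2n -scaler_nat.
by rewrite scaler_eq0 (negPf w0) orbF (negPf (Fp_two_neq0 p_pr odd_p)).
Qed.

(** Automorphisms of L acting on single summands and permutations of the summands suffice. A nonzero
    invariant subspace meets one summand nontrivially, so contains it by irreducibility of L, and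
    then contains the others by permutation. *)
Lemma IAC_alg_pow (p : nat) (L : algebra 'F_p) (k : nat) :
  prime p -> odd p -> 0 < k -> IAC L -> IAC (alg_pow L k).
Proof.
move=> p_pr odd_p k_gt0 iacL; have [altL ntL irrL] := iacL.
have actP (s : 'S_k) (a : 'I_k -> {perm finvect_type L}) :
    (forall i, a i \in alg_Aut L) ->
  exists2 b, b \in alg_Aut (alg_pow L k) &
    forall (x : alg_pow L k) i, (b x : alg_pow L k) i = a i (x (s i)).
  move=> Aa; pose f (x : alg_pow L k) : alg_pow L k := [ffun i => a i (x (s i)) : L].
  have f_inj : injective (f : finvect_type (alg_pow L k) -> finvect_type (alg_pow L k)).
    move=> x y /ffunP exy; apply/ffunP=> i.
    have := exy (s^-1 i); rewrite !ffunE permKV; exact: (@perm_inj _ (a (s^-1 i))).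
  exists (perm f_inj) => [|x i]; last by rewrite permE ffunE.
  apply/alg_AutP; split=> [c x y|x y]; rewrite !permE; apply/ffunP=> i.
    by rewrite !ffunE; have /alg_AutP[la _] := Aa i; apply: la.
  by rewrite !ffunE; have /alg_AutP[_ ma] := Aa i; apply: ma.
pose inj i (w : L) : alg_pow L k := [ffun j => if j == i then w else 0%R].
split.
- by move=> x; apply/ffunP=> i; rewrite !ffunE altL.
- have w0 : vpick {:L} != 0%R by rewrite vpick0.
  apply: contraNneq w0 => pow0; have := memvf (inj (Ordinal k_gt0) (vpick {:L})).
  by rewrite pow0 memv0 => /eqP/ffunP/(_ (Ordinal k_gt0)); rewrite !ffunE eqxx => ->.
move=> U invU; have [-> | ntU] := eqVneq U 0%VS; [by left | right].
have [i ui0] : exists i, vpick U i != 0%R.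
  apply/existsP; rewrite -negb_forall; apply: contra ntU => /forallP u0.
  by rewrite -vpick0; apply/eqP/ffunP=> i; rewrite ffunE; apply/eqP.
have [a Aa aui] := IAC_alg_Aut_moves p_pr odd_p iacL ui0.
pose at_i (b : {perm finvect_type L}) j := if j == i then b else 1.
have Aat_i b : b \in alg_Aut L -> forall j, at_i b j \in alg_Aut L.
  by move=> Ab j; rewrite /at_i; case: ifP => // _; apply: group1.
(* [W] is the intersection of [U] with the i-th summand, seen inside L. *)
have [||W WE] := @Fp_additive_vspace _ L (fun w => inj i w \in U).
- suff -> : inj i 0%R = 0%R by apply: mem0v.
  by apply/ffunP=> j; rewrite !ffunE if_same.
- move=> x y Ux Uy; rewrite unfold_in.
  suff -> : inj i (x + y)%R = (inj i x + inj i y)%R by apply: memvD.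
  by apply/ffunP=> j; rewrite !ffunE; case: ifP; rewrite ?addr0.
have Wfull : W = fullv.
  have [b Ab w||//] := irrL W.
  - rewrite !WE => Uw; have [c Ac cE] := actP 1 _ (Aat_i b Ab).
    suff -> : inj i (b w) = c (inj i w) by apply: invU.
    apply/ffunP=> j; rewrite cE perm1 /at_i !ffunE; case: ifP => // _.
    by rewrite perm1.
  (* Applying a in the i-th place only and subtracting leaves a vector of [U] supported at i,
     nonzero by the choice of a. *)
  move=> W0; case/eqP: aui; apply/eqP; rewrite -subr_eq0 -memv0 -W0 WE.
  have [c Ac cE] := actP 1 _ (Aat_i a Aa).
  suff -> : inj i (a (vpick U i) - vpick U i)%R = (c (vpick U) - vpick U)%R.
    by rewrite memvB ?memv_pick // invU ?memv_pick.
  apply/ffunP=> j; have -> : (c (vpick U) - vpick U : alg_pow L k)%R j =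
      ((c (vpick U) : alg_pow L k) j - vpick U j)%R by rewrite !ffunE.
  by rewrite cE perm1 /at_i ffunE; case: eqP => [->//|_]; rewrite perm1 subrr.
have Uinj j w : inj j w \in U.
  have Uw : inj i w \in U by rewrite -WE Wfull memvf.
  have [c Ac cE] := actP (tperm i j) (fun _ => 1) (fun _ => group1 _).
  suff -> : inj j w = c (inj i w) by apply: invU.
  apply/ffunP=> l; rewrite cE perm1 !ffunE.
  by rewrite -(inj_eq (@perm_inj _ (tperm i j))) tpermR.
apply/vspaceP=> x; rewrite memvf.
have -> : x = (\sum_j inj j (x j))%R.
  apply/ffunP=> l; rewrite sum_ffunE (bigD1 l) //= ffunE eqxx big1 ?addr0 // => j ne_jl.
  by rewrite ffunE eq_sym (negPf ne_jl).
by apply: memv_suml.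
Qed.

(** * The bijection and its consequences for automorphisms, subgroups and powers *)

Theorem theorem1p1 (p : nat) (p_pr : prime p) (odd_p : odd p) :
  induces_bijection
    (fun _ : UCSp2 p => True) (fun G H : UCSp2 p => G \isog H)
    (fun L : algebra 'F_p => IAC L) (fun L M : algebra 'F_p => alg_isom L M)
    (fun G : UCSp2 p => Frattini_algebra odd_p G)
  /\
  forall G : UCSp2 p, let L := Frattini_algebra odd_p G in
  [/\ (* (a) *) ~~ abelian G -> Aut G / Aut_C G \isog alg_Aut L,
      (* (b), (c) *)
      exists f : {vspace L} -> {group UCS_type G},
        induces_bijection
          (fun U : {vspace L} => subalgebra U) (fun U V => U = V)
          (fun H : {group UCS_type G} =>
             [/\ 'Phi(G) \subset H, H \subset G & powerful p H])
          (fun H K => H = K) f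
        /\
        induces_bijection
          (fun U : {vspace L} => ideal U) (fun U V => U = V)
          (fun N : {group UCS_type G} =>
             'Phi(G) \subset N /\ powerfully_embedded p N G)
          (fun H K => H = K) f
    & (* (d) *) forall k, 2 <= k ->
        exists Gk_UCS : in_UCSp2 p (direct_power G k),
          alg_isom (Frattini_algebra odd_p (MkUCSp2 Gk_UCS)) (alg_pow L k)].
Proof.
split.
  split=> [G _|G H _ _ isoGH|G H _ _ [f bij_f fM]|L iacL].
  - exact: Frattini_algebra_IAC.
  - exact: (Frattini_algebra_isom odd_p (Frattini_coordinatized odd_p H)).
  - have [phi [isophi _]] := coord_lift p_pr odd_p
      (Frattini_coordinatized odd_p G) (Frattini_coordinatized odd_p H)
      (linearD f) fM bij_f.
    exact: isom_isog isophi.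
  have [altL _ _] := iacL.
  have [gT [G [pi cG]]] := coordinatized_exists p_pr odd_p altL.
  exists (MkUCSp2 (coord_UCSp2 p_pr odd_p cG iacL)) => //.
  (* The constructed group has two coordinate systems, its Frattini one and the one with values in
     [L]; comparing them along the identity gives the isomorphism. *)
  exact: (@Frattini_algebra_isom _ _ (MkUCSp2 _) _ _ _ _ cG (isog_refl G)).
move=> G L; split=> [|| k k_gt1]; first exact: Aut_quotient_Aut_C.
  exists (@Frattini_preim_group p odd_p G); split.
    split=> [U subU|U V _ _ ->//|U V _ _|H [sPH sHG pH]].
    - split; [exact: Frattini_Phi_preim | exact: Frattini_preim_sub |].
      exact/Frattini_powerfulP.
    - exact: Frattini_preim_inj.
    have [U UH] := Frattini_preim_surj odd_p sPH sHG; exists U => //.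
    by apply/Frattini_powerfulP; rewrite UH.
  split=> [U idU|U V _ _ ->//|U V _ _|N [sPN pN]].
  - by split; [exact: Frattini_Phi_preim | exact/Frattini_powerfully_embeddedP].
  - exact: Frattini_preim_inj.
  have /andP[sNG _] := pN.
  have [U UN] := Frattini_preim_surj odd_p sPN sNG; exists U => //.
  by apply/Frattini_powerfully_embeddedP; rewrite UN.
(* The power of G has coordinates in the power of [L], which is again irreducible, so (d) follows in
   the same way as surjectivity. *)
have cGk := alg_pow_coordinatized k (Frattini_coordinatized odd_p G).
have iacLk := IAC_alg_pow p_pr odd_p (ltnW k_gt1) (Frattini_algebra_IAC odd_p G).
exists (coord_UCSp2 p_pr odd_p cGk iacLk).
exact: (@Frattini_algebra_isom _ _ (MkUCSp2 _) _ _ _ _ cGk (isog_refl _)).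
Qed.
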